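(* Let $\mathbb{K}\in\{\mathbb{R},\mathbb{C},\mathbb{H}\}$, $m\geq1$, and let $b$ be a nondegenerate hermitian or anti-hermitian $\tau$-sesquilinear form on $\mathbb{K}^m$ as described in the context, with $SU(b)$ not compact. Then the Thurston compactification $\overline{\mathcal{E}^b_m}^{\mathcal{T}}$ of the space $\mathcal{E}^b_m$ of (isometry classes of) self-dual marked lattices is $SU(b)$-isomorphic to the Satake compactification $\overline{\mathcal{E}^b_m}^{\mathcal{S}}$, i.e. there is an $SU(b)$-equivariant homeomorphism between them commuting with the embeddings of $\mathcal{E}^b_m$.
   Context: $\mathbb{H}$ is the skew field of Hamilton quaternions. $\mathbb{K}^m$ is a right $\mathbb{K}$-vector space, matrices act on the left, $\langle x,y\rangle=\sum_i\overline{x_i}y_i$, $\|x\|=\sqrt{\langle x,x\rangle}$, $M^*={}^t\overline{M}$, $U_m(\mathbb{K})=\{M: MM^*=I_m\}$, and $SU_m(\mathbb{K})=U_m(\mathbb{K})\cap SL_m(\mathbb{K})$ (Dieudonné determinant for $\mathbb{H}$). The order $\mathcal{O}$: if $\mathbb{K}=\mathbb{R}$, $\mathcal{O}=\mathbb{Z}$; if $\mathbb{K}=\mathbb{C}$, $\mathcal{O}$ is an order in an imaginary quadratic field embedded in $\mathbb{C}$; if $\mathbb{K}=\mathbb{H}$, $\mathcal{O}$ is an order in a quaternion algebra $A$ over $\mathbb{Q}$ not split over $\mathbb{R}$, with $A\otimes_{\mathbb{Q}}\mathbb{R}=\mathbb{H}$. An $\mathcal{O}$-lattice of $\mathbb{K}^m$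 is a right $\mathcal{O}$-submodule generated by a $\mathbb{K}$-basis; covolume is normalized so that $\mathcal{O}^m$ has covolume $1$. A marked lattice is a morphism of right $\mathcal{O}$-modules $f:\mathcal{O}^m\to\mathbb{K}^m$ whose image is a lattice; it extends uniquely to a $\mathbb{K}$-linear automorphism of $\mathbb{K}^m$. $\mathcal{E}_m$ is the space of marked lattices of covolume $1$ modulo $f\sim k\circ f$ ($k\in U_m(\mathbb{K})$); it is identified with $\{\gamma\in GL_m(\mathbb{K}):|\det\gamma|=1\}/U_m(\mathbb{K})=SL_m(\mathbb{K})/SU_m(\mathbb{K})$ by $\gamma U_m(\mathbb{K})\mapsto[\gamma^*|_{\mathcal{O}^m}]$, left translation by $g$ becoming $g\cdot[f]=[f\circ g^*]$. The form $b$: $\tau$ is $\mathrm{id}$ if $\mathbb{K}=\mathbb{R}$, either $\mathrm{id}$ or conjugation if $\mathbb{K}=\mathbb{C}$, and conjugation if $\mathbb{K}=\mathbb{H}$. The form is $b(x,y)={}^t(x^\tau)Jy$ with $J\in U_m(\mathbb{K})\cap GL_m(\mathcal{O})$, and it is $\tau$-hermitian or $\tau$-anti-hermitian. $SU(b)\subset GL_m(\mathbb{K})$ is the group of automorphisms preserving $b$ (its elements have determinant of modulus $1$). The dual of a lattice $\Lambda$ is $\Lambda^{*b}=\{y\in\mathbb{K}^m:\forall x\in\Lambda,\ b(x,y)\in\mathcal{O}\}$, and $\Lambda$ is self-dual if $\Lambda^{*b}=\Lambda$. The standard lattice $\mathcal{O}^m$, marked by the identity $f_0$, is self-dual, and all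 lattices $g^*\mathcal{O}^m$, $g\in SU(b)$, are self-dual. $\mathcal{E}_m^b\subset\mathcal{E}_m$ is the set of classes $[g^*\circ f_0]$, $g\in SU(b)$; it is identified with $SU(b)/(SU(b)\cap U_m(\mathbb{K}))$. Compactifications: $\mathbb{P}(\mathbb{R}_+^{\mathcal{O}^m})$ is the quotient of $\mathbb{R}_+^{\mathcal{O}^m}\setminus\{0\}$ (product topology) by homotheties of positive ratio. $\overline{\mathcal{E}_m^b}^{\mathcal{T}}$ is the closure of the image of $\mathcal{E}^b_m$ under the embedding $\phi:\mathcal{E}_m\to\mathbb{P}(\mathbb{R}_+^{\mathcal{O}^m})$, $[f]\mapsto[u\mapsto\|f(u)\|]$; every point of it is the class of a function $\ell_f:u\mapsto\|f(u)\|$ with $f$ a nonzero endomorphism of $\mathbb{K}^m$, and $g\in SU(b)$ acts by $g\cdot[\ell_f]=[\ell_{f\circ g^*}]$. $\overline{\mathcal{E}_m^b}^{\mathcal{S}}$ is the closure of the image of $\mathcal{E}^b_m$ under the embedding $\gamma U_m(\mathbb{K})\mapsto\mathbb{R}\gamma\gamma^*$ of $\mathcal{E}_m$ into the real projective space of the space of hermitian matrices, on which $g$ acts by $g\cdot\mathbb{R}h=\mathbb{R}ghg^*$. Two $G$-compactifications $(C,i)$, $(C',i')$ of a space $X$ ($i,i'$ embeddings with dense image into compact $G$-spaces, equivariant for the $G$-action on $X$) are $G$-isomorphic if there is a $G$-equivariant homeomorphism $F:C\to C'$ with $i'=F\circ i$. *)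

(* Defs.v *)
From HB Require Import structures.
From mathcomp Require Import all_boot all_order all_algebra.
From mathcomp Require Import all_classical all_reals all_analysis.
From mathcomp.real_closed Require Import complex.
From mathcomp Require Import ring lra.

Set Implicit Arguments.
Unset Strict Implicit.
Unset Printing Implicit Defensive.

Import Order.TTheory GRing.Theory Num.Theory.
Import numFieldNormedType.Exports.
Local Open Scope classical_set_scope.
Local Open Scope ring_scope.
Local Open Scope quotient_scope.

(* The common interface of R, C and H: a real algebra with its canonical
   involution [conjugate], its real part [re] and real coordinates [coords],
   which also fix the topology. *)
HB.mixin Record isStarDivAlg (R : realType) K
    of GRing.Algebra R K & Topological K := {
  conjugate : K -> K;
  re : K -> R;
  rdim : nat;
  coords : K -> 'rV[R]_rdim;
  of_coords : 'rV[R]_rdim -> K;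
  conj_linear : linear conjugate;
  conjM : forall x y : K, conjugate (x * y) = conjugate y * conjugate x;
  conjK : involutive conjugate;
  addr_conj : forall x : K, x + conjugate x = (2 * re x)%:A;
  mul_conj : forall x : K, conjugate x * x = (re (conjugate x * x))%:A;
  re_conj_gt0 : forall x : K, x != 0 -> 0 < re (conjugate x * x);
  coords_linear : linear coords;
  coordsK : cancel coords of_coords;
  of_coordsK : cancel of_coords coords;
  coords_continuous : continuous coords;
  of_coords_continuous : continuous of_coords
}.

#[short(type="starDivAlgType")]
HB.structure Definition StarDivAlg (R : realType) :=
  {K of GRing.Algebra R K & Topological K & isStarDivAlg R K}.
Arguments rdim {R} K : rename.

Lemma initial_inv_continuous (T : topologicalType) (U : choiceType)
  (f : U -> T) (g : T -> U) : cancel g f ->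
  continuous (g : T -> initial_topology f).
Proof.
move=> gK; apply/continuousP => _ [A oA <-].
by rewrite -comp_preimage (_ : f \o g = id) // funeqE => x /=.
Qed.

Section RealInstance.
Variable R : realType.

Definition real_conj (x : R^o) : R^o := x.
Definition real_re (x : R^o) : R := x.
Definition real_coords (x : R^o) : 'rV[R]_1 := const_mx x.
Definition real_of_coords (v : 'rV[R]_1) : R^o := v 0 0.

Fact conjr_linear : linear real_conj. Proof. by []. Qed.
Fact conjrM (x y : R^o) : real_conj (x * y) = real_conj y * real_conj x.
Proof. by rewrite /real_conj mulrC. Qed.
Fact conjrK : involutive real_conj. Proof. by []. Qed.
Fact addr_conjr (x : R^o) : x + real_conj x = (2 * real_re x)%:A.
Proof. by rewrite /real_conj /real_re /GRing.scale /= mulr1; ring. Qed.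
Fact mul_conjr (x : R^o) : real_conj x * x = (real_re (real_conj x * x))%:A.
Proof. by rewrite /real_re /GRing.scale /= mulr1. Qed.
Fact re_conjr_gt0 (x : R^o) : x != 0 -> 0 < real_re (real_conj x * x).
Proof. by move=> x0; rewrite /real_re /real_conj -expr2 exprn_even_gt0. Qed.
Fact coordsr_linear : linear real_coords.
Proof. by move=> a x y; apply/rowP => i; rewrite !mxE. Qed.
Fact coordsrK : cancel real_coords real_of_coords.
Proof. by move=> x; rewrite /real_of_coords mxE. Qed.
Fact of_coordsrK : cancel real_of_coords real_coords.
Proof. by move=> v; apply/rowP => i; rewrite mxE !ord1. Qed.
Fact coordsr_continuous : continuous real_coords.
Proof.
move=> x A [P xP PA]; have xP00 : nbhs x (P 0 0).
  by have := xP 0 0; rewrite mxE.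
by apply: filterS xP00 => y Py; apply: PA => i j; rewrite !ord1 mxE.
Qed.
Fact of_coordsr_continuous : continuous real_of_coords.
Proof.
move=> v A vA; exists (fun _ _ => A) => [i j|w /(_ 0 0)//].
by rewrite !ord1.
Qed.

HB.instance Definition _ := @isStarDivAlg.Build R R^o real_conj real_re 1
  real_coords real_of_coords conjr_linear conjrM conjrK addr_conjr mul_conjr
  re_conjr_gt0
  coordsr_linear coordsrK of_coordsrK coordsr_continuous of_coordsr_continuous.
End RealInstance.

Section ComplexInstance.
Variable R : realType.
Local Notation C := (Rcomplex R).

Fact complex_scaleAr (a : R) (x y : C) : a *: (x * y) = x * (a *: y).
Proof.
by case: x y => [x1 x2] [y1 y2]; congr (Complex _ _); rewrite /=; ring.
Qed.
HB.instance Definition _ := GRing.Lalgebra_isAlgebra.Build R C complex_scaleAr.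

Definition complex_conj (z : C) : C := complex.conjc z.
Definition complex_re (z : C) : R := complex.Re z.
Definition complex_coords (z : C) : 'rV[R]_2 :=
  \row_i (if i == 0 then complex.Re z else complex.Im z).
Definition complex_of_coords (v : 'rV[R]_2) : C := Complex (v 0 0) (v 0 1).

HB.instance Definition _ :=
  Topological.copy C (initial_topology complex_coords).

Fact conjc_linear : linear complex_conj.
Proof. by move=> a [x1 x2] [y1 y2]; congr (Complex _ _) => /=; ring. Qed.
Fact conjcM (x y : C) : complex_conj (x * y) = complex_conj y * complex_conj x.
Proof.
by case: x y => [x1 x2] [y1 y2]; congr (Complex _ _); rewrite /=; ring.
Qed.
Fact conjcK' : involutive complex_conj.
Proof. by move=> [x1 x2]; congr (Complex _ _); rewrite opprK. Qed.
Fact addr_conjc (x : C) : x + complex_conj x = (2 * complex_re x)%:A.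
Proof. by case: x => [x1 x2]; congr (Complex _ _); rewrite /=; ring. Qed.
Fact mul_conjc (x : C) :
  complex_conj x * x = (complex_re (complex_conj x * x))%:A.
Proof. by case: x => [x1 x2]; congr (Complex _ _); rewrite /=; ring. Qed.
Fact re_conjc_gt0 (x : C) : x != 0 -> 0 < complex_re (complex_conj x * x).
Proof.
case: x => [x1 x2]; rewrite eq_complex /= negb_and /complex_re /= => x0.
have -> : x1 * x1 - - x2 * x2 = x1 ^+ 2 + x2 ^+ 2 by ring.
have := sqr_ge0 x1; have := sqr_ge0 x2.
have sq_gt0 (y : R) : y != 0 -> 0 < y ^+ 2 by move=> ?; rewrite exprn_even_gt0.
by case/orP: x0 => /sq_gt0; lra.
Qed.
Fact coordsc_linear : linear complex_coords.
Proof.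
by move=> a [x1 x2] [y1 y2]; apply/rowP => i; rewrite !mxE; case: ifP.
Qed.
Fact coordscK : cancel complex_coords complex_of_coords.
Proof. by move=> [x1 x2]; rewrite /complex_of_coords !mxE. Qed.
Fact of_coordscK : cancel complex_of_coords complex_coords.
Proof.
move=> v; apply/rowP => i; rewrite !mxE.
by case: i => [[|[|//]] ilt] /=; congr (v 0 _); apply/val_inj.
Qed.
Fact coordsc_continuous : continuous complex_coords.
Proof. exact: initial_continuous. Qed.
Fact of_coordsc_continuous : continuous complex_of_coords.
Proof. exact: initial_inv_continuous of_coordscK. Qed.

HB.instance Definition _ := @isStarDivAlg.Build R C complex_conj complex_re 2
  complex_coords complex_of_coords conjc_linear conjcM conjcK' addr_conjc
  mul_conjc re_conjc_gt0 coordsc_linear coordscK of_coordscK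
  coordsc_continuous of_coordsc_continuous.
End ComplexInstance.

(* [Quat a b c d] is the Hamilton quaternion a + b i + c j + d k. *)
Record quat (R : Type) := Quat {quat1 : R; quati : R; quatj : R; quatk : R}.

Section QuaternionRing.
Variable R : realType.
Local Notation H := (quat R).

Let to_prod (x : H) := let: Quat a b c d := x in (a, b, c, d).
Let of_prod (x : R * R * R * R) := let: (a, b, c, d) := x in Quat a b c d.
Fact quat_prodK : cancel to_prod of_prod. Proof. by case. Qed.
HB.instance Definition _ := Choice.copy H (can_type quat_prodK).

Definition addq (x y : H) : H :=
  let: Quat a b c d := x in let: Quat a' b' c' d' := y in
  Quat (a + a') (b + b') (c + c') (d + d').
Definition oppq (x : H) : H :=
  let: Quat a b c d := x in Quat (- a) (- b) (- c) (- d).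
Definition mulq (x y : H) : H :=
  let: Quat a b c d := x in let: Quat a' b' c' d' := y in
  Quat (a * a' - b * b' - c * c' - d * d') (a * b' + b * a' + c * d' - d * c')
       (a * c' - b * d' + c * a' + d * b') (a * d' + b * c' - c * b' + d * a').
Definition scaleq (r : R) (x : H) : H :=
  let: Quat a b c d := x in Quat (r * a) (r * b) (r * c) (r * d).

Fact addqA : associative addq.
Proof. by move=> [????] [????] [????]; congr Quat; ring. Qed.
Fact addqC : commutative addq.
Proof. by move=> [????] [????]; congr Quat; ring. Qed.
Fact add0q : left_id (Quat 0 0 0 0) addq.
Proof. by move=> [????]; congr Quat; ring. Qed.
Fact addNq : left_inverse (Quat 0 0 0 0) oppq addq.
Proof. by move=> [????]; congr Quat; ring. Qed.
HB.instance Definition _ := GRing.isZmodule.Build H addqA addqC add0q addNq.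

Fact mulqA : associative mulq.
Proof. by move=> [????] [????] [????]; congr Quat; ring. Qed.
Fact mul1q : left_id (Quat 1 0 0 0) mulq.
Proof. by move=> [????]; congr Quat; ring. Qed.
Fact mulq1 : right_id (Quat 1 0 0 0) mulq.
Proof. by move=> [????]; congr Quat; ring. Qed.
Fact mulqDl : left_distributive mulq addq.
Proof. by move=> [????] [????] [????]; congr Quat; ring. Qed.
Fact mulqDr : right_distributive mulq addq.
Proof. by move=> [????] [????] [????]; congr Quat; ring. Qed.
Fact oneq_neq0 : Quat 1 0 0 0 != 0 :> H.
Proof. by apply/eqP => -[/eqP]; rewrite oner_eq0. Qed.
HB.instance Definition _ := GRing.Zmodule_isNzRing.Build H
  mulqA mul1q mulq1 mulqDl mulqDr oneq_neq0.

Fact scaleqA (r s : R) (x : H) : scaleq r (scaleq s x) = scaleq (r * s) x.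
Proof. by case: x => [????]; congr Quat; ring. Qed.
Fact scale1q : left_id 1 scaleq.
Proof. by move=> [????]; congr Quat; ring. Qed.
Fact scaleqDr : right_distributive scaleq +%R.
Proof. by move=> ? [????] [????]; congr Quat; ring. Qed.
Fact scaleqDl (x : H) : {morph scaleq^~ x : r s / r + s}.
Proof. by move=> r s; case: x => [????]; congr Quat; ring. Qed.
HB.instance Definition _ := GRing.Zmodule_isLmodule.Build R H
  scaleqA scale1q scaleqDr scaleqDl.

Fact scaleqAl (r : R) (x y : H) : r *: (x * y) = (r *: x) * y.
Proof. by case: x y => [????] [????]; congr Quat; ring. Qed.
HB.instance Definition _ := GRing.Lmodule_isLalgebra.Build R H scaleqAl.
Fact scaleqAr (r : R) (x y : H) : r *: (x * y) = x * (r *: y).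
Proof. by case: x y => [????] [????]; congr Quat; ring. Qed.
HB.instance Definition _ := GRing.Lalgebra_isAlgebra.Build R H scaleqAr.

Definition quat_coords (x : H) : 'rV[R]_4 :=
  \row_i [:: quat1 x; quati x; quatj x; quatk x]`_i.
HB.instance Definition _ := Topological.copy H (initial_topology quat_coords).

Definition conjq (x : H) : H :=
  let: Quat a b c d := x in Quat a (- b) (- c) (- d).
Definition quat_of_coords (v : 'rV[R]_4) : H :=
  Quat (v 0 0) (v 0 1) (v 0 2%:R) (v 0 3%:R).

Fact conjq_linear : linear conjq.
Proof. by move=> ? [????] [????]; congr Quat; ring. Qed.
Fact conjqM (x y : H) : conjq (x * y) = conjq y * conjq x.
Proof. by case: x y => [????] [????]; congr Quat; ring. Qed.
Fact conjqK : involutive conjq.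
Proof. by move=> [????]; congr Quat; ring. Qed.
Fact addr_conjq (x : H) : x + conjq x = (2 * quat1 x)%:A.
Proof. by case: x => [????]; congr Quat => /=; ring. Qed.
Fact mul_conjq (x : H) : conjq x * x = (quat1 (conjq x * x))%:A.
Proof. by case: x => [????]; congr Quat => /=; ring. Qed.
Fact re_conjq_gt0 (x : H) : x != 0 -> 0 < quat1 (conjq x * x).
Proof.
case: x => [a b c d] x0 /=.
have -> : a * a - - b * b - - c * c - - d * d
  = a ^+ 2 + b ^+ 2 + c ^+ 2 + d ^+ 2 by ring.
rewrite lt0r !addr_ge0 ?sqr_ge0 // andbT.
apply: contra_neq x0 => /eqP.
rewrite !paddr_eq0 ?addr_ge0 ?sqr_ge0 // !sqrf_eq0.
by move=> /andP[/andP[/andP[/eqP-> /eqP->] /eqP->] /eqP->].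
Qed.
Fact coordsq_linear : linear quat_coords.
Proof.
move=> ? [????] [????]; apply/rowP => i; rewrite !mxE.
by case: i => [[|[|[|[|//]]]] ?].
Qed.
Fact coordsqK : cancel quat_coords quat_of_coords.
Proof. by move=> [????]; rewrite /quat_of_coords !mxE. Qed.
Fact of_coordsqK : cancel quat_of_coords quat_coords.
Proof.
move=> v; apply/rowP => i; rewrite !mxE.
by case: i => [[|[|[|[|//]]]] ilt] /=; congr (v 0 _); apply/val_inj.
Qed.
Fact coordsq_continuous : continuous quat_coords.
Proof. exact: initial_continuous. Qed.
Fact of_coordsq_continuous : continuous quat_of_coords.
Proof. exact: initial_inv_continuous of_coordsqK. Qed.

HB.instance Definition _ := @isStarDivAlg.Build R H conjq (@quat1 R) 4
  quat_coords quat_of_coords conjq_linear conjqM conjqK addr_conjq mul_conjq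
  re_conjq_gt0 coordsq_linear coordsqK of_coordsqK coordsq_continuous
  of_coordsq_continuous.
End QuaternionRing.

Variant scalar_kind := KReal | KComplex | KQuaternion.

Definition scalars (R : realType) (k : scalar_kind) : starDivAlgType R :=
  match k with
  | KReal => R^o
  | KComplex => Rcomplex R
  | KQuaternion => quat R
  end.

(* Vectors are columns: K^m is a right K-vector space. *)
Definition rscale (K : nzRingType) m (x : 'cV[K]_m) (a : K) : 'cV[K]_m :=
  \col_i (x i 0 * a).

Definition invertible_mx (K : nzRingType) m (A : 'M[K]_m) : Prop :=
  exists2 B : 'M[K]_m, A *m B = 1%:M & B *m A = 1%:M.

(* The columns of [E] form a basis of K^m. *)
Definition is_basis (K : nzRingType) m (E : 'M[K]_m) : Prop :=
  forall x : 'cV[K]_m, exists! c : 'cV[K]_m, x = E *m c.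

Section Hermitian.
Variables (R : realType) (K : starDivAlgType R).

HB.instance Definition _ := GRing.isLinear.Build R K K _ conjugate
  conj_linear.
HB.instance Definition _ := GRing.isLinear.Build R K 'rV[R]_(rdim K) _ coords
  coords_linear.
HB.instance Definition _ := GRing.isLinear.Build R 'rV[R]_(rdim K) K _ of_coords
  (can2_linear coordsK of_coordsK).

Definition adjmx m n (A : 'M[K]_(m, n)) : 'M[K]_(n, m) :=
  \matrix_(i, j) conjugate (A j i).

Definition dot m (x y : 'cV[K]_m) : K := \sum_i conjugate (x i 0) * y i 0.
Definition norm m (x : 'cV[K]_m) : R := Num.sqrt (re (dot x x)).

Definition hermitian_mx m (h : 'M[K]_m) : Prop := adjmx h = h.
Definition unitary_mx m (A : 'M[K]_m) : Prop := A *m adjmx A = 1%:M.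

Lemma adjmxK m n (A : 'M[K]_(m, n)) : adjmx (adjmx A) = A.
Proof. by apply/matrixP => i j; rewrite !mxE conjK. Qed.

Lemma adjmxM m n p (A : 'M[K]_(m, n)) (B : 'M[K]_(n, p)) :
  adjmx (A *m B) = adjmx B *m adjmx A.
Proof.
apply/matrixP => i j; rewrite !mxE raddf_sum /=; apply: eq_bigr => k _.
by rewrite conjM !mxE.
Qed.

Lemma conj1 : conjugate 1 = 1 :> K.
Proof. by have := conjM 1 (conjugate (1 : K)); rewrite mul1r conjK mul1r. Qed.

Lemma adjmx1 m : adjmx 1%:M = 1%:M :> 'M[K]_m.
Proof.
apply/matrixP => i j; rewrite !mxE eq_sym.
by case: eqP => _; rewrite ?conj1 // raddf0.
Qed.

Lemma dotE m (x y : 'cV[K]_m) : dot x y = (adjmx x *m y) 0 0.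
Proof. by rewrite mxE; apply: eq_bigr => i _; rewrite mxE. Qed.

(* [realmx A] is the matrix of x |-> A x in the real coordinates of K^m. *)
Definition to_real m (x : 'cV[K]_m) : 'M[R]_(m, rdim K) :=
  \matrix_(i, j) coords (x i 0) 0 j.
Definition of_real m (y : 'M[R]_(m, rdim K)) : 'cV[K]_m :=
  \col_i of_coords (row i y).
Definition real_act m (A : 'M[K]_m) (y : 'M[R]_(m, rdim K)) :=
  to_real (A *m of_real y).
Definition realmx m (A : 'M[K]_m) : 'M[R]_(m * rdim K) := lin_mx (real_act A).

Lemma to_realK m : cancel (@to_real m) (@of_real m).
Proof.
move=> x; apply/colP => i; rewrite mxE -[RHS]coordsK; congr of_coords.
by apply/rowP => j; rewrite !mxE.
Qed.

Lemma of_realK m : cancel (@of_real m) (@to_real m).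
Proof. by move=> y; apply/matrixP => i j; rewrite !mxE of_coordsK mxE. Qed.

Lemma real_act_linear m (A : 'M[K]_m) : linear (real_act A).
Proof.
move=> a x y; apply/matrixP => i j; rewrite !mxE.
rewrite [RHS](_ : _ = (a *: coords (\sum_k A i k * of_real x k 0) +
  coords (\sum_k A i k * of_real y k 0)) 0 j); last by rewrite [RHS]mxE mxE.
rewrite -linearP; congr (coords _ 0 j).
rewrite scaler_sumr -big_split; apply: eq_bigr => k _.
by rewrite !mxE linearP linearP mulrDr scalerAr.
Qed.
HB.instance Definition _ m (A : 'M[K]_m) := GRing.isLinear.Build R
  'M[R]_(m, rdim K) 'M[R]_(m, rdim K) _ (real_act A) (real_act_linear A).

Lemma realmxM m (A B : 'M[K]_m) : realmx (A *m B) = realmx B *m realmx A.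
Proof.
apply/row_matrixP => i; rewrite !rowE mulmxA.
rewrite -[delta_mx 0 i]vec_mxK !mul_vec_lin /=.
by rewrite /real_act to_realK mulmxA.
Qed.

Lemma realmx1 m : realmx (1%:M : 'M[K]_m) = 1%:M.
Proof.
apply/row_matrixP => i; rewrite !rowE mulmx1.
by rewrite -[delta_mx 0 i]vec_mxK !mul_vec_lin /= /real_act mul1mx of_realK.
Qed.

Lemma realmx_inj m : injective (@realmx m).
Proof.
move=> A B eqAB; apply/matrixP => i j.
have eq_act (x : 'cV_m) : A *m x = B *m x.
  have := congr1 (fun M => vec_mx (mxvec (to_real x) *m M)) eqAB.
  rewrite !mul_vec_lin !mxvecK /= /real_act to_realK => /(congr1 (@of_real m)).
  by rewrite !to_realK.
have := congr1 (fun v : 'cV_m => v i 0) (eq_act (delta_mx j 0)).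
by rewrite -!colE !mxE.
Qed.

Lemma mulmx1C_star m (A B : 'M[K]_m) : A *m B = 1%:M -> B *m A = 1%:M.
Proof.
move=> AB1; apply: realmx_inj; rewrite realmxM realmx1; apply: mulmx1C.
by rewrite -realmxM AB1 realmx1.
Qed.

End Hermitian.

Section Norm.
Variables (R : realType) (K : starDivAlgType R).

Lemma scalar_alg_inj : injective (fun a : R => a%:A : K).
Proof.
move=> a b /eqP; rewrite -subr_eq0 -scalerBl scaler_eq0 oner_eq0 orbF subr_eq0.
by move/eqP.
Qed.

Lemma re_is_additive : {morph (@re R K) : x y / x + y}.
Proof.
move=> x y; suff: 2 * re (x + y) = 2 * (re x + re y) :> R by lra.
by apply: scalar_alg_inj; rewrite /= mulrDr scalerDl -!addr_conj raddfD addrACA.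
Qed.

Lemma re0 : re (0 : K) = 0.
Proof. by have := re_is_additive 0 0; rewrite addr0; lra. Qed.

Lemma re_dot m (x : 'cV[K]_m) :
  re (dot x x) = \sum_i re (conjugate (x i 0) * x i 0).
Proof. by rewrite /dot (big_morph re re_is_additive re0). Qed.

Lemma re_conj_ge0 (x : K) : 0 <= re (conjugate x * x).
Proof.
have [->|/re_conj_gt0/ltW//] := eqVneq x 0; by rewrite mulr0 re0.
Qed.

Lemma re_dot_gt0 m (x : 'cV[K]_m) : x != 0 -> 0 < re (dot x x).
Proof.
move=> x0; have [i xi0] : exists i, x i 0 != 0.
  apply/not_existsP => x_eq0; case/eqP: x0; apply/colP => i; rewrite !mxE.
  by apply/eqP/negPn/negP/x_eq0.
rewrite re_dot (bigD1 i) //= ltr_pwDl ?re_conj_gt0 //.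
by apply: sumr_ge0 => j _; exact: re_conj_ge0.
Qed.

Lemma norm_ge0 m (x : 'cV[K]_m) : 0 <= norm x.
Proof. exact: sqrtr_ge0. Qed.

Lemma norm_neq0 m (x : 'cV[K]_m) : x != 0 -> norm x != 0.
Proof. by move=> /re_dot_gt0 x0; rewrite gt_eqF // sqrtr_gt0. Qed.

Lemma unitary_adj m (k : 'M[K]_m) : unitary_mx k -> unitary_mx (adjmx k).
Proof. by rewrite /unitary_mx adjmxK => /mulmx1C_star. Qed.

Lemma unitaryM m (k l : 'M[K]_m) :
  unitary_mx k -> unitary_mx l -> unitary_mx (k *m l).
Proof.
move=> uk ul; rewrite /unitary_mx adjmxM mulmxA -(mulmxA k).
by rewrite (_ : l *m _ = 1%:M) // mulmx1.
Qed.

Lemma norm_unitary m (k : 'M[K]_m) (x : 'cV[K]_m) :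
  unitary_mx k -> norm (k *m x) = norm x.
Proof.
move=> /unitary_adj uk; rewrite /norm !dotE adjmxM -mulmxA (mulmxA (adjmx k)).
by move: uk; rewrite /unitary_mx adjmxK => ->; rewrite mul1mx.
Qed.

Lemma adjmx_mul_neq0 m (A : 'M[K]_m) : A != 0 -> adjmx A *m A != 0.
Proof.
move=> A0; have [j Aj0] : exists j, col j A != 0.
  apply/not_existsP => A_eq0; case/eqP: A0; apply/matrixP => i j.
  have /negP/negPn/eqP/(congr1 (fun v : 'cV[K]_m => v i 0)) := A_eq0 j.
  by rewrite !mxE.
apply: contraTneq (re_dot_gt0 Aj0) => AA0.
have -> : dot (col j A) (col j A) = (adjmx A *m A) j j.
  by rewrite [RHS]mxE; apply: eq_bigr => i _; rewrite !mxE.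
by rewrite AA0 mxE re0 ltxx.
Qed.

Lemma adjmx_mul_hermitian m n (A : 'M[K]_(m, n)) : hermitian_mx (adjmx A *m A).
Proof. by rewrite /hermitian_mx adjmxM adjmxK. Qed.
End Norm.

(* [O] is an order of the finite-dimensional Q-subalgebra [A] of K: a subring
   of [A], finitely generated over Z, that spans [A] over Q. *)
Definition is_order_of (R : realType) (K : starDivAlgType R) (A : set K)
    (O : subringClosed K) : Prop :=
  [/\ forall x, x \in O -> A x,
      exists r (w : 'I_r -> K), forall x, x \in O <->
        exists z : 'I_r -> int, x = \sum_i w i *~ z i
    & forall x, A x -> exists2 d : nat, (0 < d)%N & x *+ d \in O].

Section Algebras.
Variable R : realType.

(* F = Q(sqrt (- d)) *)
Definition imaginary_quadratic_field (F : set (Rcomplex R)) : Prop :=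
  exists2 d : nat, (0 < d)%N &
    F = [set z | exists a b : rat,
          z = ratr a *: 1 + ratr b *: complex.Complex 0 (Num.sqrt d%:R)].

(* [A] is the quaternion algebra (a, b / Q) with basis 1, i, j, ij; the last
   conjunct says that the inclusion of A in H induces an isomorphism from the
   tensor product of A with R onto H (both are 4-dimensional). *)
Definition definite_quaternion_algebra (A : set (quat R)) : Prop :=
  exists (i j : quat R) (a b : rat),
  [/\ a != 0 /\ b != 0,
      [/\ i * i = (ratr a)%:A, j * j = (ratr b)%:A & j * i = - (i * j)],
      A = [set q | exists x y z t : rat, q = (ratr x)%:A + ratr y *: i
                                         + ratr z *: j + ratr t *: (i * j)]
    & forall q : quat R, exists x y z t : R,
        q = x%:A + y *: i + z *: j + t *: (i * j)].

Definition is_order (k : scalar_kind) : subringClosed (scalars R k) -> Prop :=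
  match k with
  | KReal => fun O => forall x, x \in O <-> exists z : int, x = z%:~R
  | KComplex => fun O =>
      exists2 F, imaginary_quadratic_field F & is_order_of F O
  | KQuaternion => fun O =>
      exists2 A, definite_quaternion_algebra A & is_order_of A O
  end.

Definition is_involution (k : scalar_kind) :
    (scalars R k -> scalars R k) -> Prop :=
  match k with
  | KReal => fun tau => tau = id
  | KComplex => fun tau => tau = id \/ tau = conjugate
  | KQuaternion => fun tau => tau = conjugate
  end.
End Algebras.

Section MarkedLattices.
Variables (R : realType) (K : starDivAlgType R) (O : subringClosed K) (n : nat).
Local Notation m := n.+1.

Definition Ovec : Type := {u : 'cV[K]_m | u \is a mxOver O}.

Definition mkOvec (u : 'cV[K]_m) (uO : u \is a mxOver O) : Ovec :=
  exist _ u uO.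

Lemma Ovec_coef (u : Ovec) i : val u i 0 \in O.
Proof. exact/mxOverP/(valP u). Qed.

Fact delta_Ovec (j : 'I_m) : (delta_mx j 0 : 'cV[K]_m) \is a mxOver O.
Proof.
by apply/mxOverP => i k; rewrite mxE; case: andP => _; rewrite ?rpred1 ?rpred0.
Qed.
Definition Odelta (j : 'I_m) : Ovec := mkOvec (delta_Ovec j).

Lemma rscale_Ovec (u : Ovec) (a : K) :
  a \in O -> rscale (val u) a \is a mxOver O.
Proof. by move=> aO; apply/mxOverP => i k; rewrite mxE rpredM // Ovec_coef. Qed.

Definition is_lattice (L : set 'cV[K]_m) : Prop :=
  exists2 E : 'M[K]_m, is_basis E & L = range (fun u : Ovec => E *m val u).

Definition is_marked_lattice (f : Ovec -> 'cV[K]_m) : Prop :=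
  [/\ forall u v w : Ovec, val w = val u + val v -> f w = f u + f v,
      forall (u w : Ovec) a, a \in O ->
        val w = rscale (val u) a -> f w = rscale (f u) a
    & is_lattice (range f)].

(* The matrix of the extension of f to an endomorphism of K^m. *)
Definition extmx (f : Ovec -> 'cV[K]_m) : 'M[K]_m :=
  \matrix_(i, j) f (Odelta j) i 0.

(* The normalization gives O^m covolume 1: the extension of f to K^m multiplies
   the Lebesgue measure by the modulus of its determinant over the reals. *)
Definition covolume (f : Ovec -> 'cV[K]_m) : R := `|\det (realmx (extmx f))|.

Lemma extmxE f : is_marked_lattice f -> forall u, f u = extmx f *m val u.
Proof.
move=> [fD fZ _].
have f0 (u : Ovec) : val u = 0 -> f u = 0.
  move=> u0; have : f u = f u + f u by apply: fD; rewrite u0 addr0.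
  by move/eqP; rewrite -{1}[f u]addr0 => /eqP /addrI.
move=> u; pose e j : Ovec := mkOvec (rscale_Ovec (Odelta j) (Ovec_coef u j)).
have sum_e s : (\sum_(j <- s) val (e j)) \is a mxOver O.
  by apply: rpred_sum => j _; exact: valP.
pose T s : Ovec := mkOvec (sum_e s).
have fT s : f (T s) = \sum_(j <- s) rscale (f (Odelta j)) (val u j 0).
  elim: s => [|j s IHs]; first by rewrite big_nil f0 //= big_nil.
  rewrite big_cons -IHs -(fZ (Odelta j) (e j)) ?Ovec_coef //.
  by apply: fD; rewrite /= big_cons.
have -> : u = T (index_enum 'I_m).
  apply/val_inj/colP => i; rewrite /= summxE (bigD1 i) //= big1 => [|j ji].
    by rewrite !mxE !eqxx mul1r addr0.
  by rewrite !mxE eq_sym (negPf ji) mul0r.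
rewrite fT mulmx_sumr; apply: eq_bigr => j _; apply/colP => i.
rewrite !mxE (bigD1 j) //= big1 => [|k kj].
  by rewrite !mxE !eqxx mul1r addr0.
by rewrite !mxE (negPf kj) mul0r mulr0.
Qed.

Lemma marked_lattice_neq0 f : is_marked_lattice f -> exists u, f u != 0.
Proof.
move=> [_ _ [E bE rangef]].
have [u _ fu] : range f (E *m val (Odelta 0))
  by rewrite rangef; exists (Odelta 0).
exists u; rewrite fu; apply/eqP => Ee0.
have [c [_ uniq_c]] := bE 0.
have : val (Odelta 0) = 0.
  by rewrite -(uniq_c 0) ?mulmx0 // -(uniq_c (val (Odelta 0))).
by move/(congr1 (fun v : 'cV[K]_m => v 0 0))/eqP; rewrite !mxE !eqxx oner_eq0.
Qed.

Lemma extmx_neq0 f : is_marked_lattice f -> extmx f != 0.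
Proof.
move=> mf; have [u] := marked_lattice_neq0 mf; rewrite (extmxE mf).
by apply: contra_neq => ->; rewrite mul0mx.
Qed.

Definition marked_lattice : Type :=
  set_type [set f : Ovec -> 'cV[K]_m | is_marked_lattice f /\ covolume f = 1].

Lemma marked_latticeP (f : marked_lattice) : is_marked_lattice (val f).
Proof. by case: f => f /= /set_mem[]. Qed.

Definition isometric (f f' : marked_lattice) : bool :=
  `[< exists2 k : 'M[K]_m, unitary_mx k & forall u, val f' u = k *m val f u >].

Fact isometric_refl : reflexive isometric.
Proof.
move=> f; apply/asboolP; exists 1%:M; last by move=> u; rewrite mul1mx.
by rewrite /unitary_mx adjmx1 mulmx1.
Qed.
Fact isometric_sym : symmetric isometric.
Proof.
have sub f f' : isometric f f' -> isometric f' f.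
  move=> /asboolP[k uk kE]; apply/asboolP; exists (adjmx k).
    exact: unitary_adj.
  by move=> u; rewrite kE mulmxA (mulmx1C_star uk) mul1mx.
by move=> f f'; apply/idP/idP; exact: sub.
Qed.
Fact isometric_trans : transitive isometric.
Proof.
move=> f2 f1 f3 /asboolP[k uk kE] /asboolP[l ul lE]; apply/asboolP.
by exists (l *m k) => [|u]; [exact: unitaryM|rewrite lE kE mulmxA].
Qed.
Canonical isometric_equiv :=
  EquivRel isometric isometric_refl isometric_sym isometric_trans.

Definition lattice_space : Type := {eq_quot isometric}.
HB.instance Definition _ := Choice.on lattice_space.
HB.instance Definition _ := Quotient.on lattice_space.

Lemma repr_pi_isometric (f : marked_lattice) :
  exists2 k : 'M[K]_m, unitary_mx k &
    forall u, val (repr (\pi_lattice_space f)) u = k *m val f u.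
Proof.
apply/asboolP; rewrite -/(isometric _ _) isometric_sym.
by apply/eqmodP; rewrite reprK.
Qed.

Definition cone : Type := set_type
  [set l : {ptws Ovec -> R} | (forall u, 0 <= l u) /\ exists u, l u != 0].
HB.instance Definition _ := Topological.on cone.
Definition mkcone (l : {ptws Ovec -> R})
  (lP : (forall u, 0 <= l u) /\ exists u, l u != 0) : cone :=
  exist _ l (mem_set lP).

Definition homothetic (l l' : cone) : bool :=
  `[< exists2 c : R, 0 < c & forall u, val l' u = c * val l u >].

Fact homothetic_refl : reflexive homothetic.
Proof. by move=> l; apply/asboolP; exists 1 => // u; rewrite mul1r. Qed.
Fact homothetic_sym : symmetric homothetic.
Proof.
have sub l l' : homothetic l l' -> homothetic l' l.
  move=> /asboolP[c c0 cE]; apply/asboolP.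
  exists c^-1; first by rewrite invr_gt0.
  by move=> u; rewrite cE mulKf // gt_eqF.
by move=> l l'; apply/idP/idP; exact: sub.
Qed.
Fact homothetic_trans : transitive homothetic.
Proof.
move=> l2 l1 l3 /asboolP[c c0 cE] /asboolP[d d0 dE]; apply/asboolP.
by exists (d * c) => [|u]; [exact: mulr_gt0|rewrite dE cE mulrA].
Qed.
Canonical homothetic_equiv :=
  EquivRel homothetic homothetic_refl homothetic_sym homothetic_trans.

Definition proj_cone : topologicalType :=
  quotient_topology {eq_quot homothetic}.

Definition length_fun (f : Ovec -> 'cV[K]_m) : {ptws Ovec -> R} :=
  fun u => norm (f u).
Definition endo (A : 'M[K]_m) : Ovec -> 'cV[K]_m := fun u => A *m val u.

Fact length_cone (f : marked_lattice) :
  (forall u, 0 <= length_fun (val f) u) /\ exists u, length_fun (val f) u != 0.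
Proof.
split=> [u|]; first exact: norm_ge0.
have [u fu] := marked_lattice_neq0 (marked_latticeP f).
by exists u; apply: norm_neq0.
Qed.

Definition thurston_map (x : lattice_space) : proj_cone :=
  \pi_proj_cone (mkcone (length_cone (repr x))).

Lemma thurston_mapE (f : marked_lattice) :
  thurston_map (\pi f) = \pi_proj_cone (mkcone (length_cone f)).
Proof.
apply/eqmodP/asboolP; exists 1 => // u; rewrite mul1r /= /length_fun.
have [k uk kE] := repr_pi_isometric f.
by rewrite kE norm_unitary.
Qed.

Definition is_length_class (A : 'M[K]_m) (x : proj_cone) : Prop :=
  exists2 l : cone, val l = length_fun (endo A) & x = \pi l.

(* [thurston_act g x y] means y = g . x, where g . [l_f] = [l_(f o g^* )] for
   any nonzero endomorphism f. That this relation is the graph of an action is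
   part of [G_isomorphic] below. *)
Definition thurston_act (g : 'M[K]_m) (x y : proj_cone) : Prop :=
  exists A : 'M[K]_m, [/\ A != 0, is_length_class A x
                        & is_length_class (A *m adjmx g) y].

Definition herm_neq0 : Type :=
  set_type [set h : 'M[K]_m | hermitian_mx h /\ h != 0].
HB.instance Definition _ := Topological.on herm_neq0.
Definition mkherm (h : 'M[K]_m) (hP : hermitian_mx h /\ h != 0) : herm_neq0 :=
  exist _ h (mem_set hP).

Definition collinear (h h' : herm_neq0) : bool :=
  `[< exists2 c : R, c != 0 & val h' = c%:A *: val h >].

Fact collinear_refl : reflexive collinear.
Proof.
by move=> h; apply/asboolP; exists 1; rewrite ?oner_eq0 // !scale1r.
Qed.
Fact collinear_sym : symmetric collinear.
Proof.
have sub h h' : collinear h h' -> collinear h' h.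
  move=> /asboolP[c c0 cE]; apply/asboolP.
  exists c^-1; first by rewrite invr_eq0.
  by rewrite cE scalerA -scalerAl mul1r scalerA mulVf // !scale1r.
by move=> h h'; apply/idP/idP; exact: sub.
Qed.
Fact collinear_trans : transitive collinear.
Proof.
move=> h2 h1 h3 /asboolP[c c0 cE] /asboolP[d d0 dE]; apply/asboolP.
exists (d * c); first exact: mulf_neq0.
by rewrite dE cE scalerA -scalerAl mul1r scalerA.
Qed.
Canonical collinear_equiv :=
  EquivRel collinear collinear_refl collinear_sym collinear_trans.

Definition proj_herm : topologicalType := quotient_topology {eq_quot collinear}.

Fact gram_herm (f : marked_lattice) : let A := extmx (val f) in
  hermitian_mx (adjmx A *m A) /\ adjmx A *m A != 0.
Proof.
split; first exact: adjmx_mul_hermitian.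
by apply/adjmx_mul_neq0/extmx_neq0/marked_latticeP.
Qed.

(* The class of f, whose extension to K^m has matrix A, corresponds to the coset
   of gamma = A^*, hence is mapped to the line of gamma gamma^* = A^* A. *)
Definition satake_map (x : lattice_space) : proj_herm :=
  \pi_proj_herm (mkherm (gram_herm (repr x))).

Lemma satake_mapE (f : marked_lattice) :
  satake_map (\pi f) = \pi_proj_herm (mkherm (gram_herm f)).
Proof.
apply/eqmodP/asboolP; exists 1; rewrite ?oner_eq0 // !scale1r /=.
have [k uk kE] := repr_pi_isometric f.
have -> : extmx (val (repr (\pi_lattice_space f))) = k *m extmx (val f).
  apply/matrixP => i j; rewrite !mxE kE mxE.
  by apply: eq_bigr => l _; rewrite mxE.
have := unitary_adj uk; rewrite /unitary_mx adjmxK => uk'.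
by rewrite adjmxM -mulmxA (mulmxA (adjmx k)) uk' mul1mx.
Qed.

Definition satake_act (g : 'M[K]_m) (x y : proj_herm) : Prop :=
  exists h h' : herm_neq0,
    [/\ x = \pi h, y = \pi h' & val h' = g *m val h *m adjmx g].

Variable b : 'cV[K]_m -> 'cV[K]_m -> K.

(* No condition on the determinant: it has modulus 1 on this whole group. *)
Definition SU : set 'M[K]_m :=
  [set g | invertible_mx g /\ forall x y, b (g *m x) (g *m y) = b x y].

(* The classes of g^* o f_0, g in SU(b), where f_0 is the inclusion of O^m. *)
Definition selfdual_space : set lattice_space :=
  [set x | exists2 g, SU g &
           exists2 f : marked_lattice, val f = endo (adjmx g) & x = \pi f].
End MarkedLattices.
Arguments selfdual_space {R K} O {n} b.

(* A space [C] with an action of [G], given as the graph of (g, x) |-> g . x,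
   and a map from [X] to [C]. *)
Record Gspace_under (G X : Type) := GspaceUnder {
  Gspace :> topologicalType;
  Gact : G -> Gspace -> Gspace -> Prop;
  Gmap : X -> Gspace
}.

Definition closure_under (G X : Type) (P : topologicalType)
    (S : set G) (Gact : G -> P -> P -> Prop) (E : set X) (i : X -> P) :
    Gspace_under (set_type S) (set_type E) :=
  @GspaceUnder (set_type S) (set_type E) (set_type (closure (i @` E)))
    (fun g x y => Gact (val g) (val x) (val y))
    (fun x => exist _ (i (val x)) (mem_set (subset_closure
       (ex_intro2 _ _ (val x) (set_valP x) erefl)))).

Definition homeomorphism (C D : topologicalType) (F : C -> D) : Prop :=
  continuous F /\
  exists2 F' : D -> C, continuous F' & cancel F F' /\ cancel F' F.

(* The third clause says that [C] is stable under the action and the last one,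
   [F] being bijective, that [F] is equivariant. *)
Definition G_isomorphic (G X : Type) (C D : Gspace_under G X) : Prop :=
  exists F : C -> D,
  [/\ homeomorphism F,
      forall x : X, F (Gmap C x) = Gmap D x,
      forall (g : G) (x : C), exists y, Gact g x y
    & forall (g : G) (x y : C), Gact g x y -> Gact g (F x) (F y)].

Section Form.
Variables (R : realType) (K : starDivAlgType R) (m : nat).
Implicit Types (tau : K -> K) (b : 'cV[K]_m -> 'cV[K]_m -> K).

Definition sesqui_form tau (J : 'M[K]_m) (x y : 'cV[K]_m) : K :=
  ((map_mx tau x)^T *m J *m y) 0 0.

Definition in_GL_over (O : subringClosed K) (J : 'M[K]_m) : Prop :=
  J \is a mxOver O /\ exists2 J' : 'M[K]_m,
    J' \is a mxOver O & J *m J' = 1%:M /\ J' *m J = 1%:M.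

Definition nondegenerate_form b : Prop :=
  forall y, (forall x, b x y = 0) -> y = 0.

Definition is_hermitian_form tau b : Prop :=
  forall x y, b y x = tau (b x y).

Definition is_antihermitian_form tau b : Prop :=
  forall x y, b y x = - tau (b x y).
End Form.

Section Compactifications.
Variables (R : realType) (K : starDivAlgType R) (O : subringClosed K) (n : nat).
Variable b : 'cV[K]_n.+1 -> 'cV[K]_n.+1 -> K.

Definition thurston_compactification :
    Gspace_under (set_type (SU b)) (set_type (selfdual_space O b)) :=
  closure_under (SU b) (@thurston_act R K O n) (selfdual_space O b)
    (@thurston_map R K O n).

Definition satake_compactification :
    Gspace_under (set_type (SU b)) (set_type (selfdual_space O b)) :=
  closure_under (SU b) (@satake_act R K n) (selfdual_space O b)
    (@satake_map R K O n).
End Compactifications.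

(* Main.v *)
From HB Require Import structures.
Require Import Defs.
From mathcomp Require Import all_boot all_order all_algebra.
From mathcomp Require Import all_classical all_reals all_analysis.
From mathcomp.real_closed Require Import complex.
From mathcomp Require Import ring lra.

Set Implicit Arguments.
Unset Strict Implicit.
Unset Printing Implicit Defensive.

Import Order.TTheory GRing.Theory Num.Theory.
Import numFieldNormedType.Exports.
Local Open Scope classical_set_scope.
Local Open Scope ring_scope.
Local Open Scope quotient_scope.

(** A nonzero endomorphism A of K^m has a length function l_A : u |-> |A u| on
    O^m and a Gram matrix A^* A, and they carry the same information: writing
    q_h(u) = re (u^* h u) for a hermitian matrix h, the square of l_A is q_h for
    h = A^* A. The class of g^* in the space of self-dual lattices is sent to
    the class of l_A by the Thurston embedding and to that of A^* A by the Satake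
    embedding, both with A = g^*. So the theorem says that the passage between
    l_A and A^* A is a homeomorphism which survives in the limit.

    From matrices to lengths, [h] |-> [sqrt |q_h|] is continuous on the whole
    projective space of hermitian matrices ([length_map]); it forgets signs of
    indefinite forms, but not on classes of Gram matrices. In the other
    direction, O spans K over the reals, so by polarization each entry of h is a
    fixed linear combination of finitely many values of q_h on O^m ([herm_of]).
    This formula is continuous for pointwise convergence, whence the inverse map
    is continuous on classes of lengths l_A ([gram_class_open]).

    The limit points also have to come from endomorphisms. The set of all l_A is
    closed in R^(O^m), because l_A at the standard basis vectors bounds the
    columns of A, so that A stays in a compact set while l_A stays near a given
    function ([lengths_closed]). Hence the classes of lengths are closed, and so
    are the classes of Gram matrices, which are cut out of the preimage under
    [length_map] by the closed condition that q_h does not change sign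
    ([gram_classes_closed]).

    Finally g acts on endomorphisms by A |-> A g^*. As g^* need not preserve
    O^m, this is not a continuous operation on all of R^(O^m); the stability of
    the Thurston closure is therefore deduced from the Satake side, where
    h |-> g h g^* is continuous ([closure_translate]). That this map permutes
    the classes of self-dual lattices requires g^* to have covolume 1 for g in
    SU(b), which follows by taking real determinants in the identity expressing
    the invariance of b ([SU_det]). *)

(** * The real part and dual families *)

Section RealPart.
Variables (R : realType) (K : starDivAlgType R).
Implicit Types x y : K.

Lemma re_is_linear : linear_for *%R (@re R K).
Proof.
move=> a x y; suff: 2 * re (a *: x + y) = 2 * (a * re x + re y) :> R by lra.
apply: (@scalar_alg_inj R K); rewrite -addr_conj linearP addrACA -scalerDr.
by rewrite !addr_conj scalerA -scalerDl; congr (_ *: _); ring.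
Qed.
HB.instance Definition _ := GRing.isLinear.Build R K R _ (@re R K) re_is_linear.

Lemma reZ a x : re (a *: x) = a * re x.
Proof. exact: scalarZ. Qed.

Lemma re_conj x : re (conjugate x) = re x.
Proof.
suff: 2 * re (conjugate x) = 2 * re x :> R by lra.
by apply: (@scalar_alg_inj R K); rewrite /= -!addr_conj conjK addrC.
Qed.

(** The trace form (x, y) |-> re (x y) is nondegenerate, since y can be the
    conjugate of x. *)
Lemma re_mulr_inj x : (forall y, re (x * y) = 0) -> x = 0.
Proof.
move=> x0; apply/eqP/negPn/negP => nx0.
have : conjugate x != 0.
  by apply: contra_neq nx0 => /(congr1 conjugate); rewrite conjK raddf0.
by move=> /re_conj_gt0; rewrite conjK x0 ltxx.
Qed.

Section DualFamily.
Variables (d : nat) (w : 'I_d -> K).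

Definition pairing (v : 'rV[R]_(rdim K)) : 'rV[R]_d :=
  \row_a re (of_coords v * w a).

Lemma pairing_is_linear : linear pairing.
Proof.
by move=> a u v; apply/rowP => i; rewrite !mxE linearP mulrDl -scalerAl linearP.
Qed.
HB.instance Definition _ := GRing.isLinear.Build R _ _ _ pairing
  pairing_is_linear.

(** By nondegeneracy of the trace form, an element x of K is determined by the
    numbers re (x w_a) when the w_a span K. This linear map to R^d is injective,
    and a linear left inverse of it provides the c_a. *)
Lemma dual_family :
  (forall x, exists r : 'I_d -> R, x = \sum_a r a *: w a) ->
  exists c : 'I_d -> K, forall x, x = \sum_a re (x * w a) *: c a.
Proof.
move=> span_w; have free : row_free (lin1_mx pairing).
  apply: inj_row_free => v; rewrite mul_rV_lin1 => /rowP v0.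
  rewrite -[v]of_coordsK (_ : of_coords v = 0) ?raddf0 //.
  apply: re_mulr_inj => y; have [r ->] := span_w y.
  rewrite mulr_sumr raddf_sum big1 //= => a _.
  rewrite -scalerAr reZ; have := v0 a; rewrite !mxE => ->.
  by rewrite mulr0.
exists (fun a => of_coords (row a (pinvmx (lin1_mx pairing)))) => x.
rewrite -[LHS]coordsK -[coords x]mulmx1 -(mulmxVp free) mulmxA mul_rV_lin1.
rewrite mulmx_sum_row raddf_sum; apply: eq_bigr => a _.
by rewrite /= linearZ /= mxE coordsK.
Qed.
End DualFamily.
End RealPart.

(** * Hermitian forms and their values on the standard lattice *)

Section HermitianForms.
Variables (R : realType) (K : starDivAlgType R).

Definition qform m (h : 'M[K]_m) (u : 'cV[K]_m) : R :=
  re ((adjmx u *m h *m u) 0 0).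

Lemma adjmxD m n (A B : 'M[K]_(m, n)) : adjmx (A + B) = adjmx A + adjmx B.
Proof. by apply/matrixP => i j; rewrite !mxE raddfD. Qed.

Lemma qformD m (h : 'M[K]_m) u v : hermitian_mx h ->
  qform h (u + v) = qform h u + qform h v + 2 * re ((adjmx u *m h *m v) 0 0).
Proof.
move=> hh; rewrite /qform adjmxD !mulmxDl !mulmxDr.
have -> : adjmx v *m h *m u = adjmx (adjmx u *m h *m v).
  by rewrite !adjmxM adjmxK hh mulmxA.
have reD (A B : 'M[K]_1) : re ((A + B) 0 0) = re (A 0 0) + re (B 0 0).
  by rewrite mxE raddfD.
have reJ (A : 'M[K]_1) : re (adjmx A 0 0) = re (A 0 0) by rewrite mxE re_conj.
by rewrite !reD reJ; ring.
Qed.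

Lemma qformZ m (r : R) (h : 'M[K]_m) u : qform (r%:A *: h) u = r * qform h u.
Proof.
rewrite /qform (_ : r%:A *: h = map_mx (fun x => r *: x) h); last first.
  by apply/matrixP => i j; rewrite !mxE -scalerAl mul1r.
rewrite -reZ !mxE scaler_sumr; congr re.
apply: eq_bigr => j _; rewrite !mxE scalerAl scaler_sumr; congr (_ * _).
by apply: eq_bigr => i _; rewrite !mxE scalerAr.
Qed.

Lemma sqr_norm m (x : 'cV[K]_m) : norm x ^+ 2 = re (dot x x).
Proof.
by rewrite sqr_sqrtr // re_dot sumr_ge0 // => i _; exact: re_conj_ge0.
Qed.

Lemma qform_gram m (A : 'M[K]_m) u :
  qform (adjmx A *m A) u = norm (A *m u) ^+ 2.
Proof. by rewrite sqr_norm /qform dotE adjmxM !mulmxA. Qed.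
End HermitianForms.

Section Recovery.
Variables (R : realType) (K : starDivAlgType R) (O : subringClosed K) (n : nat).
Local Notation m := n.+1.
Variables (d : nat) (w c : 'I_d -> K).
Hypothesis wO : forall a, w a \in O.
Hypothesis dualwc : forall x : K, x = \sum_a re (x * w a) *: c a.
Local Notation Ovec := (Ovec O n).

Definition probe (j : 'I_m) (a : 'I_d) : Ovec :=
  mkOvec (rscale_Ovec (Odelta O j) (wO a)).

Fact addO (u v : Ovec) : val u + val v \is a mxOver O.
Proof. by rewrite rpredD //; exact: valP. Qed.

(** If p is the quadratic form of h, this is twice the real part of the
    sesquilinear form of h at e_i and e_j w_a, that is of h_ij w_a. *)
Definition polar (p : Ovec -> R) (i j : 'I_m) (a : 'I_d) : R :=
  p (mkOvec (addO (Odelta O i) (probe j a))) - p (Odelta O i) - p (probe j a).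

(** The first half of the sum is 2 h_ij when p is the quadratic form of h. The
    second half makes the result hermitian for every p, so that it defines a
    point of the projective space of hermitian matrices as soon as it is
    nonzero. *)
Definition herm_of (p : Ovec -> R) : 'M[K]_m :=
  \matrix_(i, j) (4^-1 *: \sum_a (polar p i j a *: c a
                                + polar p j i a *: conjugate (c a))).

Lemma herm_of_hermitian p : hermitian_mx (herm_of p).
Proof.
apply/matrixP => i j; rewrite !mxE linearZ /= raddf_sum; congr (_ *: _).
by apply: eq_bigr => a _ /=; rewrite linearD !linearZ /= conjK addrC.
Qed.

Lemma herm_ofZ r p : herm_of (fun u => r * p u) = r%:A *: herm_of p.
Proof.
apply/matrixP => i j; rewrite !mxE -scalerAl mul1r !scaler_sumr.
apply: eq_bigr => a _; rewrite scalerA [r * _]mulrC -scalerA; congr (_ *: _).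
by rewrite scalerDr !scalerA /polar !mulrBr.
Qed.

Lemma polar_qform h i j a : hermitian_mx h ->
  polar (fun u => qform h (val u)) i j a = 2 * re (h i j * w a).
Proof.
move=> hh; rewrite /polar /= qformD //.
have -> : (adjmx (delta_mx i 0 : 'cV_m) *m h *m rscale (delta_mx j 0) (w a)) 0 0
  = h i j * w a.
  have eE k : rscale (delta_mx j 0) (w a) k 0 = (k == j)%:R * w a.
    by rewrite !mxE eqxx andbT.
  rewrite mxE (bigD1 j) //= big1 ?addr0 => [|k kj]; last first.
    by rewrite eE (negPf kj) mul0r mulr0.
  rewrite eE eqxx mul1r; congr (_ * _).
  rewrite mxE (bigD1 i) //= big1 ?addr0 => [|k ki]; last first.
    by rewrite !mxE (negPf ki) /= raddf0 mul0r.
  by rewrite !mxE !eqxx conj1 mul1r.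
ring.
Qed.

Lemma herm_of_qform h : hermitian_mx h ->
  herm_of (fun u => qform h (val u)) = h.
Proof.
move=> hh; apply/matrixP => i j; rewrite mxE.
under eq_bigr do rewrite !polar_qform // -!scalerA.
rewrite big_split /= -!scaler_sumr -dualwc.
have -> : \sum_a re (h j i * w a) *: conjugate (c a) = h i j.
  rewrite -[h in RHS]hh [RHS]mxE [in RHS](dualwc (h j i)) raddf_sum.
  by apply: eq_bigr => a _; rewrite /= linearZ.
rewrite -scalerDr -mulr2n -[h i j *+ 2]scaler_nat !scalerA.
by rewrite (_ : 4^-1 * _ * _ = 1) ?scale1r //; field.
Qed.

(** The values on O^m determine a hermitian matrix, as O^m spans K^m over R. *)
Lemma qform_lattice_inj h h' : hermitian_mx h -> hermitian_mx h' ->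
  (forall u : Ovec, qform h (val u) = qform h' (val u)) -> h = h'.
Proof.
move=> hh hh' hE; rewrite -(herm_of_qform hh) -(herm_of_qform hh').
by congr herm_of; apply/funext => u.
Qed.
End Recovery.

(** * Continuity in matrices and in functions on the lattice *)

Section ProductContinuity.

Lemma mx_continuous (T U : topologicalType) m n (M : T -> 'M[U]_(m, n)) :
  (forall i j, continuous (fun t => M t i j)) -> continuous M.
Proof.
move=> cM t A [P Pt PA]; apply: (@filterS _ _ _ _ _ (fun s => PA (M s))).
apply: (@filter_forall _ _ (fun i s => forall j, P i j (M s i j))) => i.
apply: (@filter_forall _ _ (fun j s => P i j (M s i j))) => j.
exact: cM (Pt i j).
Qed.

Lemma entry_continuous (T : topologicalType) m n i j :
  continuous (fun A : 'M[T]_(m, n) => A i j).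
Proof.
move=> A V VA; exists (fun i' j' => [set x | i' = i -> j' = j -> V x]).
  move=> i' j'; have [->|/eqP ni] := eqVneq i' i.
    have [->|/eqP nj] := eqVneq j' j.
      by apply: filterS VA => x Vx _ _; exact: Vx.
    by apply: filterS filterT => x _ _ ji; case: nj.
  by apply: filterS filterT => x _ ii; case: ni.
by move=> B /(_ i j); exact.
Qed.

Lemma ptws_continuous (T V : topologicalType) (I : Type)
    (f : T -> {ptws I -> V}) :
  (forall i, continuous (fun t => f t i)) -> continuous f.
Proof.
move=> cf t; apply/cvg_sup => i U [_ [[W oW <-] Wft sub]].
apply: (@filterS _ _ _ _ _ (fun s => sub (f s))).
by apply: (cf i t W); exact: open_nbhs_nbhs.
Qed.

Lemma ptws_eval_continuous (V : topologicalType) (I : eqType) (i : I) :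
  continuous (fun f : {ptws I -> V} => f i).
Proof. exact: (@proj_continuous I (fun=> V) i). Qed.

Lemma sum_continuous (R : realType) (T : topologicalType) (I : finType)
    (f : I -> T -> R) :
  (forall i, continuous (f i)) -> continuous (fun t => \sum_i f i t).
Proof.
by move=> cf; apply: continuous_big => // x; exact: add_continuous.
Qed.

(** Near a point y of the closure, the range agrees with the image of a compact
    set, which is closed. *)
Lemma closed_range_coercive (T U : topologicalType) (f : T -> U) :
  hausdorff_space U -> continuous f ->
  (forall y : U, exists2 N, nbhs y N &
     exists2 C, compact C & f @^-1` N `<=` C) ->
  closed (range f).
Proof.
move=> hU cf coercive y cly; have [N yN [C cC NC]] := coercive y.
have : closed (f @` C).
  apply: compact_closed => //; apply: continuous_compact => //.
  exact: continuous_subspaceT.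
move=> /(_ y)[|x Cx <-]; last by exists x.
move=> V yV; have [_ [[x _ <-] [Vx Nx]]] := cly _ (filterI yV yN).
by exists (f x); split=> //; exists x => //; exact: NC.
Qed.
End ProductContinuity.

Section ScalarContinuity.
Variables (R : realType) (K : starDivAlgType R).

Lemma coord_of_continuous i : continuous (fun x : K => coords x 0 i).
Proof.
move=> x; apply: (@continuous_comp _ _ _ (@coords R K) (fun v => v 0 i)).
  exact: coords_continuous.
exact: entry_continuous.
Qed.

Lemma continuous_to_scalars (T : topologicalType) (f : T -> K) :
  (forall i, continuous (fun t => coords (f t) 0 i)) -> continuous f.
Proof.
move=> cf; have -> : f = @of_coords R K \o (fun t => coords (f t)).
  by apply/funext => t /=; rewrite coordsK.
move=> t; apply: continuous_comp; last exact: of_coords_continuous.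
by apply: mx_continuous => i j; rewrite ord1; exact: cf.
Qed.

(** The topology of K is that of its real coordinates, so real-linear forms are
    continuous. *)
Lemma linear_form_continuous (f : K -> R) : linear_for *%R f -> continuous f.
Proof.
move=> lf; pose F : {linear K -> R | *%R} :=
  HB.pack f (GRing.isLinear.Build R K R _ f lf).
have -> : f = fun x => \sum_i coords x 0 i * f (of_coords (delta_mx 0 i)).
  apply/funext => x; rewrite -[f]/(F : K -> R) -{1}[x]coordsK.
  rewrite {1}[coords x]row_sum_delta !raddf_sum /=; apply: eq_bigr => i _.
  by rewrite linearZ; exact: (scalarZ F).
apply: sum_continuous => i x; apply: cvgM; last exact: cvg_cst.
exact: coord_of_continuous.
Qed.

Lemma linear_entry_continuous m n i j (f : K -> R) : linear_for *%R f ->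
  continuous (fun A : 'M[K]_(m, n) => f (A i j)).
Proof.
move=> lf A; apply: (@continuous_comp _ _ _ (fun A : 'M[K]_(m, n) => A i j) f).
  exact: entry_continuous.
exact: linear_form_continuous.
Qed.

Lemma coord_entry_continuous m n i j k :
  continuous (fun A : 'M[K]_(m, n) => coords (A i j) 0 k).
Proof.
move=> A; apply: (@continuous_comp _ _ _ (fun A : 'M[K]_(m, n) => A i j)
  (fun x : K => coords x 0 k)).
  exact: entry_continuous.
exact: coord_of_continuous.
Qed.

Lemma neq0_mx_open m n : open [set A : 'M[K]_(m, n) | A != 0].
Proof.
rewrite openE => A /= A0.
have [i [j [k Aijk]]] : exists i j k, coords (A i j) 0 k != 0.
  apply: contrapT => noA; case/eqP: A0; apply/matrixP => i j.
  rewrite mxE -[LHS]coordsK -[RHS]coordsK raddf0; congr of_coords.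
  apply/rowP => k; rewrite [RHS]mxE; apply/eqP/negPn/negP => Aijk.
  by apply: noA; exists i, j, k.
have VA : nbhs (coords (A i j) 0 k) [set r : R | r != 0].
  by apply: open_nbhs_nbhs; split => //; exact: open_neq.
have {}VA : nbhs A [set B | coords (B i j) 0 k != 0].
  exact: (coord_entry_continuous VA).
apply: filterS VA => B /=.
by apply: contra_neq => ->; rewrite mxE raddf0 mxE.
Qed.

Lemma sandwich_coord_linear (x z : K) k :
  linear_for *%R (fun y => coords (x * y * z) 0 k).
Proof.
move=> a u v /=; rewrite mulrDr mulrDl -scalerAr -scalerAl linearP /=.
by rewrite !mxE.
Qed.

Lemma qform_continuous m (u : 'cV[K]_m) : continuous (fun h => qform h u).
Proof.
have -> : (fun h => qform h u) = fun h =>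
    \sum_i \sum_j re (conjugate (u j 0) * h j i * u i 0).
  apply/funext => h; rewrite /qform mxE raddf_sum; apply: eq_bigr => i _ /=.
  rewrite mxE mulr_suml raddf_sum; apply: eq_bigr => j _ /=.
  by rewrite mxE.
apply: sum_continuous => i; apply: sum_continuous => j.
apply: (linear_entry_continuous
  (f := fun x => re (conjugate (u j 0) * x * u i 0))) => a x y /=.
by rewrite mulrDr mulrDl -scalerAr -scalerAl linearP.
Qed.

Lemma congruence_continuous m (g g' : 'M[K]_m) :
  continuous (fun h => g *m h *m g').
Proof.
apply: mx_continuous => i j; apply: continuous_to_scalars => k.
have -> : (fun h => coords ((g *m h *m g') i j) 0 k) = fun h =>
    \sum_q \sum_p coords (g i p * h p q * g' q j) 0 k.
  apply/funext => h; rewrite mxE raddf_sum summxE; apply: eq_bigr => q _.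
  by rewrite mxE mulr_suml raddf_sum summxE.
apply: sum_continuous => q; apply: sum_continuous => p.
exact: linear_entry_continuous (sandwich_coord_linear _ _ _).
Qed.

(** Only finitely many values of p occur in [herm_of], hence continuity for
    pointwise convergence. *)
Lemma herm_of_continuous (O : subringClosed K) n d (w c : 'I_d -> K)
    (wO : forall a, w a \in O) :
  continuous (herm_of c wO : {ptws Ovec O n -> R} -> 'M[K]_n.+1).
Proof.
apply: mx_continuous => i j; apply: continuous_to_scalars => k.
have -> : (fun p : {ptws Ovec O n -> R} => coords (herm_of c wO p i j) 0 k) =
    fun p => 4^-1 * \sum_a (polar wO p i j a * coords (c a) 0 k
      + polar wO p j i a * coords (conjugate (c a)) 0 k).
  apply/funext => p; rewrite mxE linearZ mxE raddf_sum summxE; congr (_ * _).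
  by apply: eq_bigr => a _ /=; rewrite linearD !linearZ !mxE.
have cpolar i' j' a :
    continuous (fun p : {ptws Ovec O n -> R} => polar wO p i' j' a).
  have cev u := @ptws_eval_continuous R (Ovec O n) u.
  move=> p; exact: cvgB (cvgB (cev _ p) (cev _ p)) (cev _ p).
pose F a (p : {ptws Ovec O n -> R}) := polar wO p i j a * coords (c a) 0 k
  + polar wO p j i a * coords (conjugate (c a)) 0 k.
have cF : continuous (fun p => \sum_a F a p).
  apply: sum_continuous => a p.
  exact: cvgD (cvgM (cpolar i j a p) (cvg_cst _))
    (cvgM (cpolar j i a p) (cvg_cst _)).
by move=> p; exact: cvgM (cvg_cst _) (cF p).
Qed.
End ScalarContinuity.

(** * Lengths of endomorphisms *)

Section Lengths.
Variables (R : realType) (K : starDivAlgType R).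
Hypothesis coords_iso :
  forall x y : K, re (conjugate x * y) = \sum_i coords x 0 i * coords y 0 i.

Lemma sqr_norm_coords m (x : 'cV[K]_m) :
  norm x ^+ 2 = \sum_i \sum_k coords (x i 0) 0 k ^+ 2.
Proof.
rewrite sqr_norm re_dot; apply: eq_bigr => i _; rewrite coords_iso.
by apply: eq_bigr => k _; rewrite expr2.
Qed.

Lemma coord_le_norm m (x : 'cV[K]_m) i k : `|coords (x i 0) 0 k| <= norm x.
Proof.
rewrite -(@ler_pXn2r _ 2) ?nnegrE ?norm_ge0 // sqr_norm_coords real_normK //.
  rewrite (bigD1 i) //= (bigD1 k) //= -addrA lerDl addr_ge0 //.
    by apply: sumr_ge0 => l _; exact: sqr_ge0.
  by apply: sumr_ge0 => j _; apply: sumr_ge0 => l _; exact: sqr_ge0.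
exact: num_real.
Qed.

Lemma norm_mul_continuous m (u : 'cV[K]_m) :
  continuous (fun A : 'M[K]_m => norm (A *m u)).
Proof.
have -> : (fun A : 'M[K]_m => norm (A *m u)) = fun A => Num.sqrt
    (\sum_i \sum_k (\sum_j coords (1 * A i j * u j 0) 0 k) ^+ 2).
  apply/funext => A; rewrite -[LHS](ger0_norm (norm_ge0 _)) -sqrtr_sqr.
  rewrite sqr_norm_coords; congr Num.sqrt; apply: eq_bigr => i _.
  apply: eq_bigr => k _; congr (_ ^+ 2); rewrite mxE raddf_sum summxE.
  by apply: eq_bigr => j _; rewrite mul1r.
move=> A; apply: (@continuous_comp _ _ _ _ Num.sqrt); last first.
  exact: sqrt_continuous.
move: A; apply: sum_continuous => i; apply: sum_continuous => k A.
have cA : continuous (fun A : 'M[K]_m => \sum_j coords (1 * A i j * u j 0) 0 k).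
  apply: sum_continuous => j.
  exact: linear_entry_continuous (sandwich_coord_linear _ _ _).
exact: cvgM (cA A) (cA A).
Qed.

Lemma box_compact m (B : 'I_m -> R) : compact
  [set A : 'M[K]_m | forall i j k, `|coords (A i j) 0 k| <= B j].
Proof.
pose T : eqType := ('I_m * 'I_m * 'I_(rdim K))%type.
pose mat (f : {ptws T -> R}) : 'M[K]_m :=
  \matrix_(i, j) of_coords (\row_k f (i, j, k)).
have matE f i j k : coords (mat f i j) 0 k = f (i, j, k).
  by rewrite mxE of_coordsK mxE.
have -> : [set A : 'M[K]_m | forall i j k, `|coords (A i j) 0 k| <= B j]
    = mat @` [set f | forall x : T, `[- B x.1.2, B x.1.2]%classic (f x)].
  apply/seteqP; split=> [A AB|_ [f fB <-] i j k]; last first.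
    by rewrite matE ler_norml; have := fB (i, j, k); rewrite /= in_itv.
  exists (fun x => coords (A x.1.1 x.1.2) 0 x.2).
    by move=> x /=; rewrite in_itv /= -ler_norml.
  apply/matrixP => i j; rewrite -[LHS]coordsK -[RHS]coordsK.
  by congr of_coords; apply/rowP => k; rewrite matE.
apply: (@continuous_compact _ _ mat); last first.
  exact: (@tychonoff T (fun=> R) (fun x => `[- B x.1.2, B x.1.2]%classic)
    (fun=> @segment_compact _ _ _)).
apply: continuous_subspaceT.
apply: mx_continuous => i j; apply: continuous_to_scalars => k.
have -> : (fun f => coords (mat f i j) 0 k) = (fun f => f (i, j, k)).
  by apply/funext => f; exact: matE.
exact: ptws_eval_continuous.
Qed.

(** The columns of A are the images of the standard basis vectors, so a bound on
    finitely many lengths confines A to a compact box. *)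
Lemma lengths_closed (O : subringClosed K) n :
  closed (range (fun A : 'M[K]_n.+1 => length_fun (endo (O := O) A))).
Proof.
apply: closed_range_coercive.
- apply: (@hausdorff_product (Ovec O n) (fun=> R)) => u; exact: Rhausdorff.
- by apply: ptws_continuous => u; exact: norm_mul_continuous.
move=> l; exists [set l' | forall j, l' (Odelta O j) < l (Odelta O j) + 1].
  apply: (@filter_forall _ _ (fun j (l' : {ptws Ovec O n -> R}) =>
    l' (Odelta O j) < l (Odelta O j) + 1) (nbhs l)).
  move=> j; apply: (@ptws_eval_continuous _ _ (Odelta O j) l [set r | r < _]).
  apply: open_nbhs_nbhs; split; first exact: open_lt.
  by rewrite /= ltrDl.
exists [set A : 'M[K]_n.+1 | forall i j k,
          `|coords (A i j) 0 k| <= l (Odelta O j) + 1].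
  exact: box_compact.
move=> A /= Al i j k; apply: le_trans (ltW (Al j)).
have -> : A i j = (A *m val (Odelta O j)) i 0 by rewrite -colE mxE.
exact: coord_le_norm.
Qed.
End Lengths.

(** * The projective spaces of lengths and of hermitian matrices *)

Section QuotientTopology.
Variables (T : topologicalType) (Q : quotType T).
Local Notation TQ := (quotient_topology Q).

Lemma quotient_closed (C : set TQ) : closed (\pi_TQ @^-1` C) -> closed C.
Proof.
move=> cC; rewrite -[C]setCK; apply: open_closedC.
exact: closed_openC cC.
Qed.
End QuotientTopology.

Section Scaling.
Variables (R : realType) (K : starDivAlgType R).

Lemma adjmxZ m n (r : R) (A : 'M[K]_(m, n)) :
  adjmx (r%:A *: A) = r%:A *: adjmx A.
Proof.
by apply/matrixP => i j; rewrite !mxE -!scalerAl !mul1r linearZ.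
Qed.

Lemma hermitianZ m (r : R) (h : 'M[K]_m) :
  hermitian_mx h -> hermitian_mx (r%:A *: h).
Proof. by rewrite /hermitian_mx adjmxZ => ->. Qed.

Lemma normZ m (r : R) (x : 'cV[K]_m) : norm (r%:A *: x) = `|r| * norm x.
Proof.
rewrite -[`|r|]sqrtr_sqr /norm -sqrtrM ?sqr_ge0 // !re_dot mulr_sumr.
congr Num.sqrt; apply: eq_bigr => i _.
by rewrite mxE -scalerAl mul1r linearZ -scalerAl -scalerAr scalerA reZ expr2.
Qed.

Lemma length_funZ (O : subringClosed K) n (r : R) (A : 'M[K]_n.+1) u :
  length_fun (endo (O := O) (r%:A *: A)) u = `|r| * length_fun (endo A) u.
Proof. by rewrite /length_fun /endo -scalemxAl normZ. Qed.
End Scaling.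

Section ProjectiveSpaces.
Variables (R : realType) (K : starDivAlgType R) (O : subringClosed K) (n : nat).
Local Notation m := n.+1.
Local Notation Ovec := (Ovec O n).
Local Notation cone := (cone O n).
Local Notation herm_neq0 := (herm_neq0 K n).
Local Notation proj_cone := (proj_cone O n).
Local Notation proj_herm := (proj_herm K n).
Hypothesis coords_iso :
  forall x y : K, re (conjugate x * y) = \sum_i coords x 0 i * coords y 0 i.
Variables (d : nat) (w c : 'I_d -> K).
Hypothesis wO : forall a, w a \in O.
Hypothesis dualwc : forall x : K, x = \sum_a re (x * w a) *: c a.
Local Notation qform_inj := (qform_lattice_inj wO dualwc).

Lemma herm_neq0P (h : herm_neq0) : hermitian_mx (val h) /\ val h != 0.
Proof. by case: h => h /= /set_mem. Qed.

Lemma cone_valP (l : cone) : (forall u, 0 <= val l u) /\ exists u, val l u != 0.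
Proof. by case: l => l /= /set_mem. Qed.

Lemma herm_val_continuous : continuous (val : herm_neq0 -> 'M[K]_m).
Proof. exact: (@initial_continuous _ _ set_val). Qed.

Lemma cone_val_continuous : continuous (val : cone -> {ptws Ovec -> R}).
Proof. exact: (@initial_continuous _ _ set_val). Qed.

Lemma proj_cone_eqP (l l' : cone) :
  reflect (exists2 r : R, 0 < r & forall u, val l' u = r * val l u)
    (\pi_proj_cone l == \pi_proj_cone l').
Proof.
by apply: (iffP eqP) => [/eqmodP/asboolP|lE] //; apply/eqmodP/asboolP.
Qed.

Lemma proj_herm_eqP (h h' : herm_neq0) :
  reflect (exists2 r : R, r != 0 & val h' = r%:A *: val h)
    (\pi_proj_herm h == \pi_proj_herm h').
Proof.
by apply: (iffP eqP) => [/eqmodP/asboolP|lE] //; apply/eqmodP/asboolP.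
Qed.

Lemma qform_neq0 (h : 'M[K]_m) : hermitian_mx h -> h != 0 ->
  exists u, qform h (val (u : Ovec)) != 0.
Proof.
move=> hh h0; apply: contrapT => /forallNP q0; case/eqP: h0.
apply: qform_inj => //; first by apply/matrixP => i j; rewrite !mxE raddf0.
move=> u; rewrite [RHS](_ : _ = 0); last first.
  by rewrite /qform mulmx0 mul0mx mxE re0.
by apply/eqP/negPn/negP; exact: q0.
Qed.

(** The absolute value makes this defined for indefinite h too, so that no
    domain has to be singled out in the projective space of hermitian matrices. *)
Definition abs_length (h : 'M[K]_m) : {ptws Ovec -> R} :=
  fun u => Num.sqrt `|qform h (val u)|.

Lemma abs_length_continuous : continuous abs_length.
Proof.
apply: ptws_continuous => u h.
apply: (@continuous_comp _ _ _ (fun h => `|qform h (val u)|) Num.sqrt).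
  apply: (@continuous_comp _ _ _ (fun h => qform h (val u)) Num.norm).
    exact: qform_continuous.
  exact: norm_continuous.
exact: sqrt_continuous.
Qed.

Fact abs_length_cone (h : herm_neq0) :
  (forall u, 0 <= abs_length (val h) u) /\ exists u, abs_length (val h) u != 0.
Proof.
split=> [u|]; first exact: sqrtr_ge0.
have [hh h0] := herm_neq0P h; have [u qu] := qform_neq0 hh h0.
by exists u; rewrite gt_eqF // sqrtr_gt0 normr_gt0.
Qed.

Definition length_map (x : proj_herm) : proj_cone :=
  \pi_proj_cone (mkcone (abs_length_cone (repr x))).

Lemma length_mapE (h : herm_neq0) :
  length_map (\pi h) = \pi_proj_cone (mkcone (abs_length_cone h)).
Proof.
apply/eqP/proj_cone_eqP.
have /eqP/proj_herm_eqP[r r0 rE] :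
  \pi_proj_herm (repr (\pi_proj_herm h)) = \pi_proj_herm h by rewrite reprK.
exists (Num.sqrt `|r|); first by rewrite sqrtr_gt0 normr_gt0.
by move=> u /=; rewrite -sqrtrM // -normrM -qformZ -rE.
Qed.

Lemma length_map_continuous : continuous length_map.
Proof.
apply/quotient_continuous.
have -> : length_map \o \pi_proj_herm
    = \pi_proj_cone \o (fun h => mkcone (abs_length_cone h)).
  by apply/funext => h; exact: length_mapE.
move=> h; apply: continuous_comp; last exact: pi_continuous.
move: h; apply: continuous_comp_initial => h.
apply: (@continuous_comp _ _ _ (val : herm_neq0 -> 'M[K]_m) abs_length).
  exact: herm_val_continuous.
exact: abs_length_continuous.
Qed.

Definition is_gram_class (A : 'M[K]_m) (x : proj_herm) : Prop :=
  exists2 h : herm_neq0, val h = adjmx A *m A & x = \pi h.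

Lemma abs_length_gram (A : 'M[K]_m) :
  abs_length (adjmx A *m A) = length_fun (endo A).
Proof.
apply/funext => u; rewrite /abs_length qform_gram normrX.
by rewrite real_normK ?num_real // sqrtr_sqr ger0_norm // norm_ge0.
Qed.

Lemma length_map_gram A x :
  is_gram_class A x -> is_length_class A (length_map x).
Proof.
move=> [h hE ->]; exists (mkcone (abs_length_cone h)); last exact: length_mapE.
by rewrite /= hE abs_length_gram.
Qed.

Lemma gram_class_ex A : A != 0 -> exists x, is_gram_class A x.
Proof.
move=> A0; have hP := conj (adjmx_mul_hermitian A) (adjmx_mul_neq0 A0).
by exists (\pi_proj_herm (mkherm hP)); exists (mkherm hP).
Qed.

Lemma length_class_neq0 A (y : proj_cone) : is_length_class A y -> A != 0.
Proof.
move=> [l lE _]; have [_ [u lu]] := cone_valP l; apply: contra_neq lu => A0.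
rewrite lE A0 /length_fun /endo mul0mx /norm re_dot big1 ?sqrtr0 // => i _.
by rewrite mxE mulr0 re0.
Qed.

Lemma length_class_inj A (y y' : proj_cone) :
  is_length_class A y -> is_length_class A y' -> y = y'.
Proof.
move=> [l lE ->] [l' l'E ->]; congr (\pi_proj_cone _); apply/val_inj.
by rewrite lE.
Qed.

Lemma gram_class_inj A x x' : is_gram_class A x -> is_gram_class A x' -> x = x'.
Proof.
move=> [h hE ->] [h' h'E ->]; congr (\pi_proj_herm _); apply/val_inj.
by rewrite hE.
Qed.

Lemma length_classZ (r : R) A (l l' : cone) : 0 < r ->
  val l = length_fun (endo A) -> (forall u, val l' u = r * val l u) ->
  val l' = length_fun (endo (r%:A *: A)).
Proof.
by move=> r0 lE l'E; apply/funext => u; rewrite l'E lE length_funZ gtr0_norm.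
Qed.

(** If l_B = r l_A then q_(B^* B) = r^2 q_(A^* A) on O^m, so the Gram matrices
    are proportional. *)
Lemma gram_of_length A B x (y : proj_cone) :
  is_length_class A y -> is_length_class B y ->
  is_gram_class A x -> is_gram_class B x.
Proof.
move=> [l lE ->] [l' l'E /eqP/proj_cone_eqP[r r0 rE]] [h hE ->].
have B0 : B != 0 by apply: (@length_class_neq0 B (\pi_proj_cone l')); exists l'.
have [x' [h' h'E _]] := gram_class_ex B0; exists h' => //.
apply/eqP/proj_herm_eqP; exists (r ^+ 2); first by rewrite expf_neq0 ?gt_eqF.
have [hh _] := herm_neq0P h; have [hh' _] := herm_neq0P h'.
apply: qform_inj => //; first exact: hermitianZ.
move=> u; rewrite qformZ hE h'E !qform_gram -exprMn.
have := rE u; rewrite l'E lE /length_fun /endo => ->.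
by [].
Qed.

(** This is the continuity of the map from lengths to Gram matrices: the points
    of V are the classes of functions l such that the matrix recovered from l^2
    is nonzero and has its class in W. *)
Lemma gram_class_open (W : set proj_herm) : open W ->
  exists2 V : set proj_cone, open V &
    forall A x y, is_gram_class A x -> is_length_class A y -> W x <-> V y.
Proof.
move=> oW.
pose sq (p : {ptws Ovec -> R}) : {ptws Ovec -> R} := fun u => p u ^+ 2.
have csq : continuous sq.
  apply: ptws_continuous => u p.
  exact: cvgM (@ptws_eval_continuous R _ u p) (@ptws_eval_continuous R _ u p).
pose S (l : cone) := exists2 h : herm_neq0,
  val h = herm_of c wO (sq (val l)) & W (\pi h).
have S_homothetic l l' : \pi_proj_cone l = \pi_proj_cone l' -> S l -> S l'.
  move=> /eqP/proj_cone_eqP[r r0 rE] [h hE Wh].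
  have hP : hermitian_mx ((r ^+ 2)%:A *: val h) /\ (r ^+ 2)%:A *: val h != 0.
    have [hh h0] := herm_neq0P h; split; first exact: hermitianZ.
    apply: contra_neq h0 => /(congr1 (fun h => (r ^- 2)%:A *: h)).
    rewrite scaler0 scalerA -scalerAl mul1r scalerA mulVf ?scale1r //.
    by rewrite expf_neq0 ?gt_eqF.
  exists (mkherm hP).
    rewrite /= hE -herm_ofZ; congr herm_of; apply/funext => u.
    by rewrite /sq rE exprMn.
  suff <- : \pi_proj_herm h = \pi_proj_herm (mkherm hP) by [].
  by apply/eqP/proj_herm_eqP; exists (r ^+ 2) => //; rewrite expf_neq0 ?gt_eqF.
exists [set y | exists2 l, y = \pi_proj_cone l & S l].
  suff oS : open [set l | S l].
    rewrite /open /= /quotient_open.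
    suff -> : \pi_proj_cone @^-1` [set y | exists2 l, y = \pi l & S l]
      = [set l | S l] by [].
    apply/seteqP; split=> [l [l' ll' Sl']|l Sl]; last by exists l.
    by apply: S_homothetic Sl'.
  have [W' oW' WE] : open (\pi_proj_herm @^-1` W) by [].
  pose H (l : cone) := herm_of c wO (sq (val l)).
  have -> : [set l | S l] = H @^-1` (W' `&` [set h | h != 0]).
    apply/seteqP; split=> [l [h hE Wh]|l [W'l l0]].
      rewrite /= /H -hE; split; last by have [] := herm_neq0P h.
      suff : (set_val @^-1` W') h by [].
      by rewrite WE.
    have hP : hermitian_mx (H l) /\ H l != 0.
      by split => //; exact: herm_of_hermitian.
    exists (mkherm hP) => //.
    suff : (\pi_proj_herm @^-1` W) (mkherm hP) by [].
    by rewrite -WE.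
  apply: open_comp; last by apply: openI => //; exact: neq0_mx_open.
  move=> l _; apply: (@continuous_comp _ {ptws Ovec -> R} _
    (sq \o (val : cone -> {ptws Ovec -> R})) (herm_of c wO)).
    apply: (@continuous_comp _ {ptws Ovec -> R} {ptws Ovec -> R}
      (val : cone -> {ptws Ovec -> R}) sq); last exact: csq.
    exact: cone_val_continuous.
  exact: herm_of_continuous.
move=> A x y [h hE ->] [l lE ->].
have hlE : herm_of c wO (sq (val l)) = val h.
  rewrite -[RHS](herm_of_qform wO dualwc); last by have [] := herm_neq0P h.
  by congr herm_of; apply/funext => u; rewrite hE qform_gram /sq lE.
split=> [Wh|[l' ll' /(S_homothetic _ l (esym ll'))[h' h'E]]].
  by exists l => //; exists h.
by rewrite (_ : h' = h) //; apply/val_inj; rewrite h'E.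
Qed.

Lemma length_classes_closed :
  closed [set y : proj_cone | exists A, is_length_class A y].
Proof.
apply: quotient_closed.
have -> : \pi_proj_cone @^-1` [set y | exists A, is_length_class A y] =
   (val : cone -> {ptws Ovec -> R}) @^-1` range (fun A => length_fun (endo A)).
  apply/seteqP; split=> [l /= [A [l' l'E /eqP/proj_cone_eqP[r r0 rE]]]|l].
    have r1 : 0 < r^-1 by rewrite invr_gt0.
    exists (r^-1%:A *: A) => //; apply/esym; apply: (length_classZ r1 l'E) => u.
    by rewrite rE mulKf ?gt_eqF.
  by move=> [A _ AE]; exists A, l.
apply: preimage_closed; last exact: lengths_closed.
by move=> l _; exact: cone_val_continuous.
Qed.

(** A form of constant sign, without choosing the sign: this is invariant under
    all nonzero homotheties, and a closed condition. *)
Definition semidefinite (h : 'M[K]_m) : Prop :=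
  forall u v : Ovec, 0 <= qform h (val u) * qform h (val v).

Lemma semidefinite_repr (h : herm_neq0) :
  semidefinite (val (repr (\pi_proj_herm h))) <-> semidefinite (val h).
Proof.
have /eqP/proj_herm_eqP[r r0 ->] :
  \pi_proj_herm (repr (\pi_proj_herm h)) = \pi_proj_herm h by rewrite reprK.
have r2 : 0 < r * r by rewrite -expr2 exprn_even_gt0.
by split=> sh u v; have := sh u v; rewrite !qformZ mulrACA (pmulr_rge0 _ r2).
Qed.

Lemma semidefinite_closed : closed [set h : 'M[K]_m | semidefinite h].
Proof.
have -> : [set h : 'M[K]_m | semidefinite h] = \bigcap_(uv : Ovec * Ovec)
    (fun h => qform h (val uv.1) * qform h (val uv.2)) @^-1` [set r | 0 <= r].
  apply/seteqP; split=> [h sh [u v] _|h sh u v]; first exact: sh.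
  exact: (sh (u, v)).
apply: closed_bigI => -[u v] _; apply: preimage_closed; last exact: closed_ge.
have cq (z : Ovec) := @qform_continuous R K m (val z).
move=> h _; exact: cvgM (cq u h) (cq v h).
Qed.

Lemma semidefinite_sign (h : 'M[K]_m) : hermitian_mx h -> h != 0 ->
  semidefinite h ->
  exists2 e : R, e != 0 &
    forall u : Ovec, qform h (val u) = e * `|qform h (val u)|.
Proof.
move=> hh h0 sh; have [u0 q0] := qform_neq0 hh h0.
exists (Num.sg (qform h (val u0))); first by rewrite sgr_eq0.
move=> u; have := sh u0 u.
have [q0_gt|q0_lt|q00] := ltgtP 0 (qform h (val u0)).
- by rewrite pmulr_rge0 // => ?; rewrite gtr0_sg // mul1r ger0_norm.
- by rewrite nmulr_rge0 // => ?; rewrite ltr0_sg // mulN1r ler0_norm // opprK.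
- by rewrite -q00 eqxx in q0.
Qed.

(** If sqrt |q_h| is proportional to l_A and q_h has constant sign, then q_h is
    proportional to the form of A^* A on O^m, so h is proportional to A^* A. *)
Lemma gram_classes_closed :
  closed [set x : proj_herm | exists A, is_gram_class A x].
Proof.
have -> : [set x : proj_herm | exists A, is_gram_class A x] =
    length_map @^-1` [set y | exists A, is_length_class A y] `&`
    [set x : proj_herm | semidefinite (val (repr x))].
  apply/seteqP; split=> [x [A Ax]|x].
    split; first by exists A; exact: length_map_gram.
    case: Ax => h hE -> /=; apply/semidefinite_repr => u v.
    by rewrite hE !qform_gram -exprMn sqr_ge0.
  rewrite -[x]reprK; move: (repr x) => h [[A /= Ay] /semidefinite_repr sh].
  have A0 := length_class_neq0 Ay; exists A.
  have [hh h0] := herm_neq0P h; have [e e0 qE] := semidefinite_sign hh h0 sh.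
  have [x' [h' h'E _]] := gram_class_ex A0; exists h' => //.
  apply/esym/eqP/proj_herm_eqP.
  move: Ay => [l lE]; rewrite length_mapE => /esym/eqP/proj_cone_eqP[r r0 rE].
  exists (e * r ^+ 2); first by rewrite mulf_neq0 // expf_neq0 // gt_eqF.
  have [hh' _] := herm_neq0P h'.
  apply: qform_inj => //; first exact: hermitianZ.
  move=> u; rewrite qformZ h'E qform_gram qE -mulrA -exprMn; congr (_ * _).
  have := rE u; rewrite /= lE /length_fun /endo => <-.
  by rewrite /abs_length sqr_sqrtr.
apply: closedI.
  apply: preimage_closed; last exact: length_classes_closed.
  by move=> x _; exact: length_map_continuous.
apply: quotient_closed.
have -> : \pi_proj_herm @^-1` [set x : proj_herm | semidefinite (val (repr x))]
    = (val : herm_neq0 -> 'M[K]_m) @^-1` [set h | semidefinite h].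
  apply/seteqP; split=> h sh; [exact: (semidefinite_repr h).1 |].
  exact: (semidefinite_repr h).2.
apply: preimage_closed; last exact: semidefinite_closed.
by move=> h _; exact: herm_val_continuous.
Qed.
End ProjectiveSpaces.

(** * Determinants over the reals *)

(* The short name also denotes the qualifier of matrices with real entries. *)
Local Notation realmx := Defs.realmx.

Section RealDeterminant.
Variables (R : realType) (K : starDivAlgType R).
Hypothesis coords_iso :
  forall x y : K, re (conjugate x * y) = \sum_i coords x 0 i * coords y 0 i.

Lemma mxvec_dot m n (A B : 'M[R]_(m, n)) :
  (mxvec A *m (mxvec B)^T) 0 0 = \sum_i \sum_j A i j * B i j.
Proof.
rewrite mxE pair_bigA (reindex _ (curry_mxvec_bij _ _)) /=.
by apply: eq_bigr => -[i j] _; rewrite mxE !mxvecE.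
Qed.

Lemma to_real_dot m (x y : 'cV[K]_m) :
  (mxvec (to_real x) *m (mxvec (to_real y))^T) 0 0 = re (dot x y).
Proof.
rewrite mxvec_dot raddf_sum; apply: eq_bigr => i _.
by rewrite /= coords_iso; apply: eq_bigr => j _; rewrite !mxE.
Qed.

Lemma realmx_to_real m (A : 'M[K]_m) x :
  mxvec (to_real x) *m realmx A = mxvec (to_real (A *m x)).
Proof. by rewrite mul_vec_lin /= /real_act to_realK. Qed.

(** Every row vector consists of the real coordinates of some element of K^m, so
    a real matrix is determined by its bilinear form on K^m. *)
Lemma realmx_ext m (M N : 'M[R]_(m * rdim K)) :
  (forall x y : 'cV[K]_m, mxvec (to_real x) *m M *m (mxvec (to_real y))^T
                        = mxvec (to_real x) *m N *m (mxvec (to_real y))^T) ->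
  M = N.
Proof.
move=> MN; apply/matrixP => i j.
have toK v : exists x : 'cV[K]_m, v = mxvec (to_real x).
  by exists (of_real (vec_mx v)); rewrite of_realK vec_mxK.
have [[x xE] [y yE]] := (toK (delta_mx 0 i), toK (delta_mx 0 j)).
have := congr1 (fun A : 'M[R]_1 => A 0 0) (MN x y); rewrite -xE -yE -!rowE.
by rewrite !trmx_delta -!colE !mxE.
Qed.

(** The coordinates turn re <x, y> into the standard scalar product, for which
    the adjoint is the transpose. *)
Lemma realmx_adj m (A : 'M[K]_m) : realmx (adjmx A) = (realmx A)^T.
Proof.
apply: realmx_ext => x y.
rewrite realmx_to_real -mulmxA -trmx_mul realmx_to_real.
apply/matrixP => i j; rewrite !ord1 !to_real_dot !dotE.
by rewrite adjmxM adjmxK mulmxA.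
Qed.

Definition conj_act m (y : 'M[R]_(m, rdim K)) : 'M[R]_(m, rdim K) :=
  to_real (map_mx conjugate (of_real y)).

Lemma conj_act_linear m : linear (@conj_act m).
Proof.
move=> a x y; apply/matrixP => i j; rewrite !mxE.
by rewrite !linearP /= [LHS]mxE [X in X + _ = _]mxE.
Qed.
HB.instance Definition _ m := GRing.isLinear.Build R
  'M[R]_(m, rdim K) 'M[R]_(m, rdim K) _ (@conj_act m) (@conj_act_linear m).

(** Over a commutative K, conjugation of the entries of A amounts to conjugating
    its real matrix by an involution. *)
Lemma det_realmx_conj m (A : 'M[K]_m) : (forall x y : K, x * y = y * x) ->
  \det (realmx (map_mx conjugate A)) = \det (realmx A).
Proof.
move=> KC; pose C := lin_mx (@conj_act m).
have CE x : mxvec (to_real x) *m C = mxvec (to_real (map_mx conjugate x)).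
  by rewrite mul_vec_lin /= /conj_act to_realK.
have conjK2 (x : 'cV[K]_m) : map_mx conjugate (map_mx conjugate x) = x.
  by apply/matrixP => i j; rewrite !mxE conjK.
have CC : C *m C = 1%:M.
  by apply: realmx_ext => x y; rewrite mulmx1 mulmxA !CE conjK2.
have -> : realmx (map_mx conjugate A) = C *m realmx A *m C.
  apply: realmx_ext => x y; rewrite !mulmxA CE !realmx_to_real CE.
  congr (mxvec (to_real _) *m _); apply/colP => i; rewrite !mxE raddf_sum.
  by apply: eq_bigr => j _; rewrite /= conjM !mxE conjK KC.
by rewrite !det_mulmx mulrAC -det_mulmx CC det1 mul1r.
Qed.

Lemma bilinear_ext m (M N : 'M[K]_m) :
  (forall x y : 'cV[K]_m, adjmx x *m M *m y = adjmx x *m N *m y) -> M = N.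
Proof.
move=> MN; apply/matrixP => i j.
have E (L : 'M[K]_m) :
    (adjmx (delta_mx i 0 : 'cV_m) *m L *m (delta_mx j 0 : 'cV_m)) 0 0 = L i j.
  rewrite -colE mxE mxE (bigD1 i) //= big1 ?addr0 => [|k ki]; last first.
    by rewrite !mxE (negPf ki) /= raddf0 mul0r.
  by rewrite !mxE !eqxx conj1 mul1r.
by rewrite -E MN E.
Qed.

Lemma det_realmx_unit m (A : 'M[K]_m) : invertible_mx A -> \det (realmx A) != 0.
Proof.
move=> [B AB _]; apply/negP => /eqP detA.
have := congr1 (fun M => \det (realmx M)) AB.
rewrite realmxM det_mulmx detA mulr0 realmx1 det1 => /eqP.
by rewrite eq_sym oner_eq0.
Qed.

(** Invariance of b reads g'^* J g = J, where g' is g if tau is the conjugation,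
    and the matrix of conjugates of the entries of g if tau is the identity. In
    both cases g' and g have the same real determinant, whose square is thus
    1. *)
Lemma SU_det n (tau : K -> K) (J g : 'M[K]_n.+1) : unitary_mx J ->
  tau = conjugate \/ tau = id /\ (forall x y : K, x * y = y * x) ->
  SU (sesqui_form tau J) g -> `|\det (realmx (adjmx g))| = 1.
Proof.
move=> uJ tauP [_ gb]; rewrite realmx_adj det_tr.
have detJ : \det (realmx J) != 0.
  by apply: det_realmx_unit; exists (adjmx J) => //; exact: mulmx1C_star uJ.
suff [g' g'J detg'] : exists2 g' : 'M[K]_n.+1, adjmx g' *m J *m g = J
    & \det (realmx g') = \det (realmx g).
  have := congr1 (fun M => \det (realmx M)) g'J.
  rewrite !realmxM !det_mulmx realmx_adj det_tr detg'.
  rewrite mulrCA -[RHS]mulr1 => /(mulfI detJ) /(congr1 Num.norm).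
  rewrite normr1 -expr2 normrX => /eqP.
  by rewrite sqrp_eq1 ?normr_ge0 // => /eqP.
case: tauP => [tauE|[tauE KC]].
  exists g => //; apply: bilinear_ext => x y.
  have adjE (z : 'cV[K]_n.+1) : (map_mx tau z)^T = adjmx z.
    by apply/matrixP => i j; rewrite !mxE tauE.
  have := gb x y; rewrite /sesqui_form !adjE adjmxM => gbxy.
  by apply/matrixP => i j; rewrite !ord1 -gbxy !mulmxA.
exists (map_mx conjugate g); last exact: det_realmx_conj.
(* The identity is tested on conjugates to turn transposes into adjoints. *)
apply: bilinear_ext => x y; pose z := map_mx conjugate x.
have adjz : (map_mx tau z)^T = adjmx x.
  by apply/matrixP => i j; rewrite !mxE tauE.
have adjgz : (map_mx tau (g *m z))^T = adjmx x *m adjmx (map_mx conjugate g).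
  apply/matrixP => i j; rewrite !mxE tauE; apply: eq_bigr => k _.
  by rewrite !mxE conjK KC.
have := gb z y; rewrite /sesqui_form adjz adjgz => gbxy.
by apply/matrixP => i j; rewrite !ord1 -gbxy !mulmxA.
Qed.
End RealDeterminant.

Section LatticesOfMatrices.
Variables (R : realType) (K : starDivAlgType R) (O : subringClosed K) (n : nat).
Local Notation m := n.+1.
Implicit Types A : 'M[K]_m.

Lemma extmx_endo A : extmx (endo (O := O) A) = A.
Proof. by apply/matrixP => i j; rewrite mxE /endo -colE mxE. Qed.

Lemma endo_marked A : invertible_mx A -> is_marked_lattice (endo (O := O) A).
Proof.
move=> [B AB BA]; split=> [u v w wE|u w a aO wE|].
- by rewrite /endo wE mulmxDr.
- apply/colP => i; rewrite /endo wE !mxE mulr_suml.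
  by apply: eq_bigr => j _; rewrite mxE mulrA.
exists A => // x; exists (B *m x); split=> [|y ->].
  by rewrite mulmxA AB mul1mx.
by rewrite mulmxA BA mul1mx.
Qed.

Lemma invertible_adj A : invertible_mx A -> invertible_mx (adjmx A).
Proof.
by move=> [B AB BA]; exists (adjmx B); rewrite -adjmxM ?AB ?BA adjmx1.
Qed.
End LatticesOfMatrices.

(** * The three fields of scalars and their orders *)

Section ScalarKinds.
Variable R : realType.

Lemma coords_isometry (k : scalar_kind) (x y : scalars R k) :
  re (conjugate x * y) = \sum_i coords x 0 i * coords y 0 i.
Proof.
case: k x y => [x y|[a b] [a' b']|[p q r s] [p' q' r' s']].
- by rewrite big_ord1 !mxE.
- by rewrite !big_ord_recl big_ord0 !mxE /=; rewrite /re /=; ring.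
- by rewrite !big_ord_recl big_ord0 !mxE /=; rewrite /re /=; ring.
Qed.

(** Positive multiples of a spanning family still span, and the elements of the
    algebra of an order have such multiples in the order. *)
Lemma clear_denominators (K : starDivAlgType R) (O : subringClosed K) d
    (a : 'I_d -> K) :
  (forall i, exists2 e : nat, (0 < e)%N & a i *+ e \in O) ->
  (forall x, exists r : 'I_d -> R, x = \sum_i r i *: a i) ->
  exists2 w : 'I_d -> K, forall i, w i \in O &
    forall x, exists r : 'I_d -> R, x = \sum_i r i *: w i.
Proof.
move=> aO span_a.
have /choice[e eP] : forall i, exists e : nat, (0 < e)%N /\ a i *+ e \in O.
  by move=> i; have [e] := aO i; exists e.
exists (fun i => a i *+ e i) => [i|x]; first by have [] := eP i.
have [r ->] := span_a x; exists (fun i => r i / (e i)%:R).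
apply: eq_bigr => i _; have [e0 _] := eP i.
by rewrite -[a i *+ _]scaler_nat scalerA divfK // pnatr_eq0 -lt0n.
Qed.

Lemma order_spans (k : scalar_kind) (O : subringClosed (scalars R k)) :
  is_order O -> exists d (w : 'I_d -> scalars R k), (forall i, w i \in O) /\
    forall x, exists r : 'I_d -> R, x = \sum_i r i *: w i.
Proof.
case: k O => O /=.
- move=> _; exists 1%N, (fun=> 1); split=> [i|x]; first exact: rpred1.
  by exists (fun=> x); rewrite big_ord1 /GRing.scale /= mulr1.
- move=> [F [N N0 ->] [_ _ FO]].
  pose om : Rcomplex R := Complex 0 (Num.sqrt N%:R).
  pose a (i : 'I_2) : Rcomplex R := [:: 1; om]`_i.
  have [] := @clear_denominators _ O 2 a.
  + move=> i; apply: FO; case: i => [[|[|//]] ?] /=.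
      by exists 1, 0; rewrite rmorph1 rmorph0 scale0r addr0 scale1r.
    by exists 0, 1; rewrite rmorph1 rmorph0 scale0r add0r scale1r.
  + move=> [p q]; exists (fun i => [:: p; q / Num.sqrt N%:R]`_i).
    rewrite !big_ord_recl big_ord0 /=.
    have s0 : Num.sqrt N%:R != 0 :> R by rewrite gt_eqF // sqrtr_gt0 ltr0n.
    by congr Complex => /=; field.
  by move=> w wO wE; exists 2, w.
- move=> [A [i [j [p [q [_ _ -> HE]]]]] [_ _ AO]].
  pose a (l : 'I_4) : quat R := [:: 1; i; j; i * j]`_l.
  have [] := @clear_denominators _ O 4 a.
  + move=> l; apply: AO; case: l => [[|[|[|[|//]]]] ?] /=.
    * by exists 1, 0, 0, 0; rewrite rmorph1 rmorph0 !scale0r !addr0 scale1r.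
    * exists 0, 1, 0, 0.
      by rewrite rmorph1 rmorph0 !scale0r !addr0 add0r scale1r.
    * exists 0, 0, 1, 0.
      by rewrite rmorph1 rmorph0 !scale0r !addr0 !add0r scale1r.
    * by exists 0, 0, 0, 1; rewrite rmorph1 rmorph0 !scale0r !add0r scale1r.
  + move=> x; have [y [z [t [u ->]]]] := HE x.
    exists (fun l => [:: y; z; t; u]`_l).
    by rewrite !big_ord_recl big_ord0 /= addr0 !addrA.
  by move=> w wO wE; exists 4, w.
Qed.

Lemma involution_cases (k : scalar_kind) (tau : scalars R k -> scalars R k) :
  is_involution tau ->
  tau = conjugate \/ tau = id /\ (forall x y : scalars R k, x * y = y * x).
Proof.
case: k tau => tau /=; [by move->; left|case=> ->; [right|by left]|by left].
by split=> // x y; exact: mulrC.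
Qed.
End ScalarKinds.

(** * The isomorphism of compactifications *)

Lemma closure_image (T U : topologicalType) (f : T -> U) (X : set T)
    (Y : set U) x :
  continuous f -> f @` X `<=` Y -> closure X x -> closure Y (f x).
Proof.
move=> cf XY clx V /cf /clx[z [Xz Vz]].
by exists (f z); split => //; apply: XY; exists z.
Qed.

Definition in_set_type T (A : set T) x (Ax : A x) : set_type A :=
  exist (fun z => z \in A) x (mem_set Ax).

Section Congruence.
Variables (R : realType) (K : starDivAlgType R) (n : nat).
Local Notation m := n.+1.
Local Notation herm_neq0 := (herm_neq0 K n).
Local Notation proj_herm := (proj_herm K n).
Variables (g : 'M[K]_m) (ug : invertible_mx g).

Fact congruence_herm (h : herm_neq0) :
  hermitian_mx (g *m val h *m adjmx g) /\ g *m val h *m adjmx g != 0.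
Proof.
have [hh h0] := herm_neq0P h; split.
  by rewrite /hermitian_mx !adjmxM adjmxK hh mulmxA.
have [g' _ g'g] := ug; apply: contra_neq h0 => gh0.
have := congr1 (fun M => g' *m M *m adjmx g') gh0.
by rewrite !mulmxA g'g mul1mx mulmx0 mul0mx -mulmxA -adjmxM g'g adjmx1 mulmx1.
Qed.

Definition congruence (x : proj_herm) : proj_herm :=
  \pi_proj_herm (mkherm (congruence_herm (repr x))).

Lemma congruenceE (h : herm_neq0) :
  congruence (\pi h) = \pi_proj_herm (mkherm (congruence_herm h)).
Proof.
apply/eqP/proj_herm_eqP.
have /eqP/proj_herm_eqP[r r0 rE] :
  \pi_proj_herm (repr (\pi_proj_herm h)) = \pi_proj_herm h by rewrite reprK.
exists r => //=; rewrite {}rE; apply/matrixP => i j.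
rewrite [RHS]mxE -scalerAl mul1r !mxE scaler_sumr; apply: eq_bigr => k _.
rewrite !mxE scalerAl scaler_sumr; congr (_ * _); apply: eq_bigr => l _.
by rewrite !mxE -scalerAl mul1r scalerAr.
Qed.

Lemma congruence_proj_continuous : continuous congruence.
Proof.
apply/quotient_continuous.
have -> : congruence \o \pi_proj_herm
    = \pi_proj_herm \o (fun h => mkherm (congruence_herm h)).
  by apply/funext => h; exact: congruenceE.
move=> h; apply: continuous_comp; last exact: pi_continuous.
move: h; apply: continuous_comp_initial => h.
apply: (@continuous_comp _ _ _ (val : herm_neq0 -> 'M[K]_m)
  (fun h => g *m h *m adjmx g)).
  exact: herm_val_continuous.
exact: congruence_continuous.
Qed.

Lemma congruence_gram A x :
  is_gram_class A x -> is_gram_class (A *m adjmx g) (congruence x).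
Proof.
move=> [h hE ->]; exists (mkherm (congruence_herm h)); last exact: congruenceE.
by rewrite /= hE adjmxM adjmxK !mulmxA.
Qed.
End Congruence.

Section Isomorphism.
Variables (R : realType) (K : starDivAlgType R) (O : subringClosed K) (n : nat).
Local Notation m := n.+1.
Local Notation proj_cone := (proj_cone O n).
Local Notation proj_herm := (proj_herm K n).
Hypothesis coords_iso :
  forall x y : K, re (conjugate x * y) = \sum_i coords x 0 i * coords y 0 i.
Variables (d : nat) (w c : 'I_d -> K).
Hypothesis wO : forall a, w a \in O.
Hypothesis dualwc : forall x : K, x = \sum_a re (x * w a) *: c a.
Variable b : 'cV[K]_m -> 'cV[K]_m -> K.
Hypothesis SUdet : forall g, SU b g -> `|\det (realmx (adjmx g))| = 1.
Local Notation XS := (@satake_map R K O n @` selfdual_space O b).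
Local Notation XT := (@thurston_map R K O n @` selfdual_space O b).

Lemma SU_mul g g' : SU b g -> SU b g' -> SU b (g *m g').
Proof.
move=> [[h gh hg] gb] [[h' gh' hg'] gb']; split.
  exists (h' *m h).
    by rewrite mulmxA -(mulmxA g) gh' mulmx1.
  by rewrite mulmxA -(mulmxA h') hg mulmx1.
by move=> x y; rewrite -!mulmxA gb gb'.
Qed.

Lemma gram_class_satake (f : marked_lattice O n) A :
  val f = endo A -> is_gram_class A (satake_map (\pi f)).
Proof.
by move=> fE; exists (mkherm (gram_herm f));
  [rewrite /= fE extmx_endo|exact: satake_mapE].
Qed.

Lemma length_class_thurston (f : marked_lattice O n) A :
  val f = endo A -> is_length_class A (thurston_map (\pi f)).
Proof.
by move=> fE; exists (mkcone (length_cone f));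
  [rewrite /= fE|exact: thurston_mapE].
Qed.

Lemma selfdual_marked g : SU b g ->
  exists2 f : marked_lattice O n, val f = endo (adjmx g)
    & selfdual_space O b (\pi f).
Proof.
move=> gb; have fP : is_marked_lattice (endo (O := O) (adjmx g)) /\
    covolume (endo (O := O) (adjmx g)) = 1.
  split; first by apply: endo_marked; apply: invertible_adj; case: gb.
  by rewrite /covolume extmx_endo SUdet.
pose f : marked_lattice O n := in_set_type
  (fP : [set f | is_marked_lattice f /\ covolume f = 1] (endo (adjmx g))).
by exists f => //; exists g => //; exists f.
Qed.

Lemma satake_imageP x : XS x <-> exists2 g, SU b g & is_gram_class (adjmx g) x.
Proof.
split=> [[_ [g gb [f fE ->]] <-]|[g gb gx]].
  by exists g => //; exact: gram_class_satake.
have [f fE Xf] := selfdual_marked gb; exists (\pi f) => //.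
exact: gram_class_inj (gram_class_satake fE) gx.
Qed.

Lemma thurston_imageP y :
  XT y <-> exists2 g, SU b g & is_length_class (adjmx g) y.
Proof.
split=> [[_ [g gb [f fE ->]] <-]|[g gb gy]].
  by exists g => //; exact: length_class_thurston.
have [f fE Xf] := selfdual_marked gb; exists (\pi f) => //.
exact: length_class_inj (length_class_thurston fE) gy.
Qed.

Lemma closure_length_map x :
  closure XS x -> closure XT (length_map wO dualwc x).
Proof.
apply: closure_image; first exact: length_map_continuous.
move=> _ [x' /satake_imageP[g gb gx'] <-]; apply/thurston_imageP.
by exists g => //; exact: length_map_gram.
Qed.

(** A converse to [closure_length_map]: the class of l_A is in one closure
    exactly when that of A^* A is in the other. *)
Lemma closure_gram_of_length A x y : is_gram_class A x -> is_length_class A y ->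
  closure XT y -> closure XS x.
Proof.
move=> Ax Ay cly W; rewrite nbhsE => -[W' [oW' W'x] sub].
have [V oV VW] := gram_class_open wO dualwc oW'.
have [|y' [/thurston_imageP[g gb gy'] Vy']] := cly V.
  by apply: open_nbhs_nbhs; split=> //; apply/(VW _ _ _ Ax Ay).
have [x' gx'] := gram_class_ex (length_class_neq0 gy').
exists x'; split; first by apply/satake_imageP; exists g.
by apply: sub; apply/(VW _ _ _ gx' gy').
Qed.

Lemma closure_thurston y : closure XT y -> exists A, is_length_class A y.
Proof.
suff : closure XT `<=` [set y | exists A, is_length_class A y] by apply.
rewrite closureE; apply: smallest_sub; first exact: length_classes_closed.
by move=> y' /thurston_imageP[g _ gy]; exists (adjmx g).
Qed.

Lemma closure_satake x : closure XS x -> exists A, is_gram_class A x.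
Proof.
suff : closure XS `<=` [set x | exists A, is_gram_class A x] by apply.
rewrite closureE; apply: smallest_sub.
  exact: (gram_classes_closed coords_iso wO dualwc).
by move=> x' /satake_imageP[g _ gx]; exists (adjmx g).
Qed.

Lemma closure_congruence g (gb : SU b g) x :
  closure XS x -> closure XS (congruence gb.1 x).
Proof.
apply: closure_image; first exact: congruence_proj_continuous.
move=> _ [x' /satake_imageP[k kb kx'] <-]; apply/satake_imageP.
exists (g *m k); first exact: SU_mul.
by rewrite adjmxM; exact: congruence_gram.
Qed.

(** The action of g is continuous on hermitian matrices, hence the detour
    through the Gram matrix of A. *)
Lemma closure_translate g A y y' : SU b g ->
  is_length_class A y -> is_length_class (A *m adjmx g) y' ->
  closure XT y -> closure XT y'.
Proof.
move=> gb Ay Ay' cly; have [x Ax] := gram_class_ex (length_class_neq0 Ay).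
have clx := closure_gram_of_length Ax Ay cly.
have gAx := congruence_gram gb.1 Ax.
rewrite (length_class_inj Ay' (length_map_gram wO dualwc gAx)).
exact/closure_length_map/closure_congruence.
Qed.

(** The points of both closures are indexed by endomorphisms A, with the same
    identifications. The bijection sending the class of l_A to that of A^* A is
    therefore well defined, with inverse induced by [length_map], and both
    actions are given by A |-> A g^*. *)
Lemma compactifications_isomorphic :
  G_isomorphic (thurston_compactification O b) (satake_compactification O b).
Proof.
pose CS := set_type (closure XS); pose CT := set_type (closure XT).
have CSP (x : CS) : closure XS (val x) by case: x => x /= /set_mem.
have CTP (y : CT) : closure XT (val y) by case: y => y /= /set_mem.
have /choice[F FP] (y : CT) : exists x : CS,
    exists2 A, is_length_class A (val y) & is_gram_class A (val x).
  have [A Ay] := closure_thurston (CTP y).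
  have [x Ax] := gram_class_ex (length_class_neq0 Ay).
  have clx := closure_gram_of_length Ax Ay (CTP y).
  by exists (in_set_type clx); exists A.
have FE A (y : CT) (x : CS) :
    is_length_class A (val y) -> is_gram_class A (val x) -> F y = x.
  move=> Ay Ax; have [B By Bx] := FP y; apply/val_inj.
  by apply: gram_class_inj Ax; exact: (gram_of_length wO dualwc By Ay Bx).
pose F' (x : CS) : CT := in_set_type (closure_length_map (CSP x)).
have F'K : cancel F' F.
  move=> x; have [A Ax] := closure_satake (CSP x).
  by apply: (FE A) => //; exact: (length_map_gram wO dualwc Ax).
have FK : cancel F F'.
  move=> y; have [A Ay Ax] := FP y; apply/val_inj.
  exact: length_class_inj (length_map_gram wO dualwc Ax) Ay.
exists F; split.
- split.
    apply/continuousP => _ [W oW <-].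
    have [V oV VW] := gram_class_open wO dualwc oW.
    exists V => //; apply/seteqP; split=> y Vy; have [A Ay Ax] := FP y.
      exact/(VW _ _ _ Ax Ay).
    exact/(VW _ _ _ Ax Ay).
  exists F' => //; apply: continuous_comp_initial => x.
  apply: (@continuous_comp _ _ _ (val : CS -> proj_herm)
    (length_map wO dualwc)).
    exact: (@initial_continuous _ _ set_val).
  exact: length_map_continuous.
- move=> [x xP]; have [g gb [f fE xE]] := set_mem xP.
  apply: (FE (adjmx g)) => /=; rewrite xE.
    exact: length_class_thurston.
  exact: gram_class_satake.
- move=> [g gP] y; have gb := set_mem gP; have [A Ay Ax] := FP y.
  have cly' := closure_translate gb Ay _ (CTP y).
  have Ax' := congruence_gram gb.1 Ax.
  have Ay' := length_map_gram wO dualwc Ax'.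
  exists (in_set_type (cly' _ Ay')); exists A; split => //.
  exact: length_class_neq0 Ay.
- move=> [g gP] y y' [A [A0 Ay Ay']]; have gb := set_mem gP.
  have [x Ax] := gram_class_ex A0.
  have Fy : val (F y) = x.
    have [B By Bx] := FP y; apply: gram_class_inj Ax.
    exact: (gram_of_length wO dualwc By Ay Bx).
  have Fy' : val (F y') = congruence gb.1 x.
    have [B By Bx] := FP y'; apply: gram_class_inj (congruence_gram gb.1 Ax).
    exact: (gram_of_length wO dualwc By Ay' Bx).
  rewrite /= /satake_act Fy Fy'; case: Ax => h hE ->.
  exists h, (mkherm (congruence_herm gb.1 h)); split => //.
  exact: congruenceE.
Qed.
End Isomorphism.

Theorem proposition4p1 (R : realType) (k : scalar_kind) (n : nat)
    (O : subringClosed (scalars R k))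
    (tau : scalars R k -> scalars R k) (J : 'M[scalars R k]_n.+1) :
  let b := sesqui_form tau J in
  is_order O ->
  is_involution tau ->
  unitary_mx J ->
  in_GL_over O J ->
  nondegenerate_form b ->
  is_hermitian_form tau b \/ is_antihermitian_form tau b ->
  ~ compact (SU b) ->
  G_isomorphic (thurston_compactification O b) (satake_compactification O b).
Proof.
move=> b /order_spans[d [w [wO wE]]] /involution_cases tauP uJ _ _ _ _.
have [c dualwc] := dual_family wE.
apply: (compactifications_isomorphic (@coords_isometry R k) wO dualwc) => g.
exact: (SU_det (@coords_isometry R k) uJ tauP).
Qed.
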